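(* In the basic coercive setting described in the context, the Entropy-Transport functional and the dual functional satisfy $$\inf_{\gamma\in\mathcal M(X_1\times X_2)}\mathscr E(\gamma|\mu_1,\mu_2)=\sup_{\varphi\in\Phi}\mathscr D(\varphi|\mu_1,\mu_2)\qquad\text{for every }\mu_i\in\mathcal M(X_i)$$ ($\mu_1,\mu_2$ satisfying the compatibility condition of the basic setting), i.e. the Entropy-Transport value $\mathsf{ET}(\mu_1,\mu_2)$ coincides with the dual value $\mathsf D(\mu_1,\mu_2)$. Here $\Phi$ is the set of all pairs $\varphi=(\varphi_1,\varphi_2)$ of simple lower semicontinuous functions $\varphi_i:X_i\to\mathbb R$ such that $F_i^\circ(\varphi_i)$ is bounded and $\varphi_1(x_1)+\varphi_2(x_2)\le c(x_1,x_2)$ for all $(x_1,x_2)\in X_1\times X_2$, and $\mathscr D(\varphi|\mu_1,\mu_2)=\sum_{i=1}^2\int_{X_i}F_i^\circ(\varphi_i)\,d\mu_i$.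
   Context: For a Hausdorff space $X$, $\mathcal M(X)$ is the set of finite nonnegative Radon measures on $X$ (finite Borel measures, inner regular by compact sets on all Borel sets). A function is simple if it takes only finitely many (real) values. $\Gamma(\mathbb R_+)$ is the set of convex lower semicontinuous $F:[0,\infty)\to[0,\infty]$ with $\mathrm{Dom}(F)\cap(0,\infty)\ne\emptyset$, $\mathrm{Dom}(F)=\{s\ge 0:F(s)<\infty\}$. Put $F'_\infty=\lim_{s\to\infty}F(s)/s$, $F^*(\phi)=\sup_{s\ge0}(s\phi-F(s))$ and $F^\circ(\varphi)=-F^*(-\varphi)=\inf_{s\ge0}(F(s)+s\varphi)$ for $\varphi\in\mathbb R$ (possibly $-\infty$; ''bounded'' includes being real-valued). For $\gamma,\mu\in\mathcal M(X)$ with Lebesgue decomposition $\gamma=\sigma\mu+\gamma^\perp$, $\gamma^\perp\perp\mu$, set $\mathscr F(\gamma|\mu)=\int_XF(\sigma)\,d\mu+F'_\infty\gamma^\perp(X)$, with $0\cdot\infty=0$. Basic setting: $X_1,X_2$ Hausdorff spaces, $F_1,F_2\in\Gamma(\mathbb R_+)$, $c:X_1\times X_2\to[0,+\infty]$ lower semicontinuous and not identically $+\infty$, $\mu_i\in\mathcal M(X_i)$ with $m_i=\mu_i(X_i)$ satisfying the compatibility condition $(m_1\mathrm{Dom}(F_1))\cap(m_2\mathrm{Dom}(F_2))\ne\emptyset$. Coercive: at least one of the following holds: (1) $(F_1)'_\infty=(F_2)'_\infty=+\infty$; (2) $(F_1)'_\infty+(F_2)'_\infty+\inf c>0$ and $c$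 has compact sublevels. For $\gamma\in\mathcal M(X_1\times X_2)$ with marginals $\gamma_i=\pi^i_\sharp\gamma$, $\mathscr E(\gamma|\mu_1,\mu_2)=\sum_i\mathscr F_i(\gamma_i|\mu_i)+\int c\,d\gamma$. *)

(* Defs.v *)
From HB Require Import structures.
From mathcomp Require Import all_boot all_order all_algebra.
From mathcomp Require Import all_classical all_reals all_analysis.
Import Order.TTheory GRing.Theory Num.Theory numFieldNormedType.Exports.

Set Implicit Arguments.
Unset Strict Implicit.
Unset Printing Implicit Defensive.

Local Open Scope classical_set_scope.
Local Open Scope ring_scope.
Local Open Scope ereal_scope.

(* The library does not provide this join of structures on products. *)
HB.instance Definition _ (X1 X2 : ptopologicalType) :=
  Pointed.on (X1 * X2)%type.

(* [ptopologicalType] rather than [topologicalType] because measurable types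
   are pointed; nothing is lost below, since a cost [c] on [X1 * X2] that is
   not identically +oo forces both spaces to be nonempty. For a product space
   this is the Borel sigma-algebra of the product topology, which may be larger
   than the product of the Borel sigma-algebras. *)
Notation borelType X := (g_sigma_algebraType (@open X)).

Notation "{ 'borel_measure' X -> R }" :=
  {finite_measure set (borelType X) -> \bar R}
  (at level 0, X at level 37, R at level 200).

Section Radon.
Context {R : realType} {X : ptopologicalType}.

Definition radon (mu : {borel_measure X -> R}) : Prop :=
  forall B : set (borelType X), measurable B ->
    mu B = ereal_sup [set mu K | K in [set K : set X | compact K /\ K `<=` B]].

End Radon.

Section EntropyFunction.
Context {R : realType}.
(* A function [0, +oo[ -> [0, +oo] is represented by [F : R -> \bar R] whose
   values at negative reals are never used; points outside [0, +oo[ are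
   isolated in the subspace topology, so [Gamma_lsc] only constrains [F] on
   [0, +oo[. *)
Implicit Types F : R -> \bar R.

Definition Dom F : set R := [set s | (0 <= s)%R /\ F s < +oo].

Record Gamma F : Prop := {
  Gamma_ge0 : forall s, (0 <= s)%R -> 0 <= F s;
  Gamma_convex : forall s t a, (0 <= s)%R -> (0 <= t)%R -> (0 <= a <= 1)%R ->
    F (a * s + (1 - a) * t)%R <= a%:E * F s + (1 - a)%:E * F t;
  Gamma_lsc : lower_semicontinuous (F : subspace `[0%R, +oo[ -> \bar R);
  Gamma_proper : Dom F `&` `]0%R, +oo[ !=set0 }.

Definition recession F : \bar R := lim ((s^-1)%:E * F s @[s --> +oo%R]).

Definition legendre F (phi : R) : \bar R :=
  ereal_sup [set (s * phi)%:E - F s | s in `[0%R, +oo[].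

Definition Fcirc F (phi : R) : \bar R := - legendre F (- phi)%R.

End EntropyFunction.

Section RelativeEntropy.
Context {R : realType} {X : ptopologicalType}.
Implicit Types (F : R -> \bar R) (mu : {borel_measure X -> R})
  (gamma : set (borelType X) -> \bar R).

Record lebesgue_decomposition gamma mu (sigma : borelType X -> R)
    (gamma_perp : {borel_measure X -> R}) : Prop := {
  density_measurable : measurable_fun setT sigma;
  density_ge0 : forall x, (0 <= sigma x)%R;
  decomposition : forall A, measurable A ->
    gamma A = \int[mu]_(x in A) (sigma x)%:E + gamma_perp A;
  decomposition_singular : exists N : set (borelType X),
    [/\ measurable N, mu N = 0 & gamma_perp (~` N) = 0] }.

(* The set below is a singleton when [gamma] is a finite Borel measure, by
   existence and mu-a.e. uniqueness of the Lebesgue decomposition. *)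
Definition relative_entropy F gamma mu : \bar R :=
  get [set v | exists sigma gamma_perp,
    lebesgue_decomposition gamma mu sigma gamma_perp /\
    v = \int[mu]_x F (sigma x) + recession F * gamma_perp setT].

End RelativeEntropy.

Section EntropyTransport.
Context {R : realType} {X1 X2 : ptopologicalType}.
Variables (F1 F2 : R -> \bar R) (c : X1 * X2 -> \bar R).
Implicit Types gamma : {borel_measure (X1 * X2)%type -> R}.

Definition marginal1 gamma : set (borelType X1) -> \bar R :=
  pushforward gamma (fst : borelType (X1 * X2)%type -> borelType X1).

Definition marginal2 gamma : set (borelType X2) -> \bar R :=
  pushforward gamma (snd : borelType (X1 * X2)%type -> borelType X2).

Record basic_setting (mu1 : {borel_measure X1 -> R})
    (mu2 : {borel_measure X2 -> R}) : Prop := {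
  hausdorff1 : hausdorff_space X1;
  hausdorff2 : hausdorff_space X2;
  Gamma1 : Gamma F1;
  Gamma2 : Gamma F2;
  cost_ge0 : forall x, 0 <= c x;
  cost_lsc : lower_semicontinuous c;
  cost_proper : exists x, c x < +oo;
  radon1 : radon mu1;
  radon2 : radon mu2;
  compatible :
    [set (fine (mu1 setT) * s)%R | s in Dom F1] `&`
    [set (fine (mu2 setT) * s)%R | s in Dom F2] !=set0 }.

Definition coercive : Prop :=
  (recession F1 = +oo /\ recession F2 = +oo) \/
  (0 < recession F1 + recession F2 + ereal_inf (range c) /\
   forall a : R, compact [set x | c x <= a%:E]).

Definition ET_functional (mu1 : {borel_measure X1 -> R})
    (mu2 : {borel_measure X2 -> R}) gamma : \bar R :=
  relative_entropy F1 (marginal1 gamma) mu1 +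
  relative_entropy F2 (marginal2 gamma) mu2 +
  \int[gamma]_x c x.

Definition ET (mu1 : {borel_measure X1 -> R})
    (mu2 : {borel_measure X2 -> R}) : \bar R :=
  ereal_inf [set ET_functional mu1 mu2 gamma | gamma in radon].

Definition simple_lsc_admissible (X : ptopologicalType) (F : R -> \bar R)
    (phi : X -> R) : Prop :=
  [/\ finite_set (range phi),
      lower_semicontinuous (EFin \o phi) &
      exists M : R, forall x, `|Fcirc F (phi x)| <= M%:E].

Definition Phi : set ((X1 -> R) * (X2 -> R)) :=
  [set phi | [/\ simple_lsc_admissible F1 phi.1,
                 simple_lsc_admissible F2 phi.2 &
                 forall x1 x2, (phi.1 x1 + phi.2 x2)%:E <= c (x1, x2)]].

Definition dual_functional (mu1 : {borel_measure X1 -> R})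
    (mu2 : {borel_measure X2 -> R}) (phi : (X1 -> R) * (X2 -> R)) : \bar R :=
  \int[mu1]_x Fcirc F1 (phi.1 x) + \int[mu2]_x Fcirc F2 (phi.2 x).

Definition dual_value (mu1 : {borel_measure X1 -> R})
    (mu2 : {borel_measure X2 -> R}) : \bar R :=
  ereal_sup [set dual_functional mu1 mu2 phi | phi in Phi].

End EntropyTransport.

(* Main.v *)
Require Import Defs.
From HB Require Import structures.
From mathcomp Require Import all_boot all_order all_algebra.
From mathcomp Require Import all_classical all_reals all_analysis.
From mathcomp Require Import measurable_realfun ring lra.
Import Order.TTheory GRing.Theory Num.Theory numFieldNormedType.Exports.

(** Weak duality is Fenchel's inequality F°(a) <= F(s) + a s, integrated against
    the Lebesgue decomposition of each marginal, together with the constraint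
    phi1 + phi2 <= c integrated against the plan ([marginal_weak_duality],
    [weak_duality]).

    For the reverse inequality let D be the dual value, assumed finite. The
    dual problem is perturbed by replacing the cost c with c + t psi, where psi
    is a bounded function on the product space. The gap between D and the
    perturbed value, divided by t, yields a sublinear functional of psi, so the
    Hahn-Banach theorem provides a positive linear functional L on all bounded
    functions with
      D(phi) - L(phi1 + phi2) + L(f) <= D
    for every admissible pair phi, constrained or not, and every bounded f <= c
    ([dual_perturbation_functional]). Such an L is a multiplier for the
    constraint, that is, a plan that is only finitely additive.

    A finitely additive set function lam on a Hausdorff space has a Radon
    regularisation gamma, with gamma(G) <= lam(G) on open sets, and it loses no
    mass when lam is tight ([radon_regularisation]). Tightness of L is where
    coercivity enters: either the sublevels of c are compact and L(c) is
    bounded, or the entropies are superlinear and the marginals of L inherit the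
    tightness of mu1 and mu2 ([functional_tight]).

    Replacing L by gamma does not destroy the inequality. Lower semicontinuity
    of c gives int c dgamma <= sup L(f) over bounded f <= c
    ([cost_regularisation]). The dual integrand evaluated on an arbitrary finite
    Borel partition against gamma is approximated by a lower semicontinuous
    simple function evaluated against L: compact subsets of the pieces have
    disjoint open neighbourhoods, and the equality of total masses forces the
    L-mass of each neighbourhood to be close to the gamma-mass of its piece
    ([lsc_approximation]). Finally the relative entropy is the supremum of these
    partition values, because F is the supremum of its affine minorants of
    rational slope and the recession constant is the supremum of the slopes
    ([Fcirc_biconjugate], [recessionE], [entropy_value_le]). Hence gamma has
    energy at most D ([plan_of_functional]). *)

Set Implicit Arguments.
Unset Strict Implicit.
Unset Printing Implicit Defensive.

Local Open Scope classical_set_scope.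
Local Open Scope ring_scope.

(** * Separation and tubes in Hausdorff spaces *)

Section CompactSeparation.
Context {T : topologicalType}.
Implicit Types (K L : set T).

(** If every closure of a member of [F] met [K], the traces of these closures on
    [K] would generate a proper filter, and a cluster point of it in [K] would
    lie in all of the closures. *)
Lemma compact_avoids_closure (F : set_system T) (FF : Filter F) K :
  compact K -> (forall p, K p -> exists2 V, F V & ~ closure V p) ->
  exists2 V, F V & closure V `&` K = set0.
Proof.
move=> cK sep; apply: contrapT => nex.
pose G := filter_from F (fun V => closure V `&` K).
have FG : Filter G.
  apply: filter_from_filter; first by exists setT; exact: filterT.
  move=> P Q FP FQ; exists (P `&` Q); first exact: filterI.
  by move=> x [/closureI[]].
have PG : ProperFilter G.
  split => // -[V FV VK]; apply: nex; exists V => //.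
  by apply/seteqP; split.
have GK : G K by exists setT; [exact: filterT|move=> x []].
have [p [Kp clp]] := cK G PG GK.
have [V FV nVp] := sep _ Kp.
have [||x [[clx _] ncl]] := clp (closure V `&` K) (~` closure V).
- by exists V.
- by apply: open_nbhs_nbhs; split=> //; exact/closed_openC/closed_closure.
- by [].
Qed.

Hypothesis hT : hausdorff_space T.

Lemma disjoint_compacts_separated K L : compact K -> compact L ->
  K `&` L = set0 ->
  exists U V, [/\ open U, open V, K `<=` U, L `<=` V & U `&` V = set0].
Proof.
move=> cK cL KL0.
have sep p : K p -> exists2 V, set_nbhs L V & ~ closure V p.
  move=> Kp; have [q Lq|W pW WL] := @compact_avoids_closure (nbhs p) _ L cL.
    apply: contrapT => nex; suff pq : p = q.
      by have : (K `&` L) p by [split=> //; rewrite pq]; rewrite KL0.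
    by apply: hT => A B pA qB; apply: contrapT => AB; apply: nex; exists A => //
      /(_ _ qB) [x [Ax Bx]]; apply: AB; exists x.
  exists (~` closure W).
    apply/set_nbhsP; exists (~` closure W); split=> //.
      exact/closed_openC/closed_closure.
    by move=> q Lq clq; have : (closure W `&` L) q by []; rewrite WL.
  by move=> /(_ _ pW) [x [ncl Wx]]; apply: ncl; exact: subset_closure.
have [V /set_nbhsP[C [oC LC CV]] VK] := compact_avoids_closure _ cK sep.
exists (~` closure V), C; split=> //.
- exact/closed_openC/closed_closure.
- by move=> p Kp cp; have : (closure V `&` K) p by []; rewrite VK.
- apply/seteqP; split => // x [nx Cx]; apply: nx.
  by apply: subset_closure; exact: CV.
Qed.

(** The parts of [K] that miss [G1] and [G2] are disjoint compacts; removing from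
    [K] disjoint neighbourhoods of them leaves the two pieces. *)
Lemma compact_split K (G1 G2 : set T) : compact K -> open G1 -> open G2 ->
  K `<=` G1 `|` G2 -> exists K1 K2,
  [/\ compact K1, compact K2, K1 `<=` G1, K2 `<=` G2 & K = K1 `|` K2].
Proof.
move=> cK oG1 oG2 KG.
have cD G : open G -> compact (K `&` ~` G).
  by move=> oG; apply: compact_closedI => //; exact: open_closedC.
have [|U [V [oU oV KU LV UV]]] := disjoint_compacts_separated (cD _ oG1) (cD _ oG2).
  by apply/seteqP; split=> // x [[Kx n1] [_ n2]]; case: (KG _ Kx).
exists (K `&` ~` U), (K `&` ~` V); split; [exact: cD|exact: cD| | |].
- by move=> x [Kx nU]; apply: contrapT => nG; apply: nU; exact: KU.
- by move=> x [Kx nU]; apply: contrapT => nG; apply: nU; exact: LV.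
- rewrite -setIUr -setCI UV setC0 setIT //.
Qed.

(** Each [U i] is the intersection, over the other indices, of the neighbourhoods
    that the pairwise separation provides. *)
Lemma disjoint_compact_family_separated (n : nat) (K : 'I_n -> set T) :
  (forall i, compact (K i)) -> (forall i j, i != j -> K i `&` K j = set0) ->
  exists U : 'I_n -> set T, [/\ forall i, open (U i), forall i, K i `<=` U i &
    forall i j, i != j -> U i `&` U j = set0].
Proof.
move=> cK dK.
have /choice[W Wp] : forall p : 'I_n * 'I_n, exists W : set T * set T,
    p.1 != p.2 -> [/\ open W.1, open W.2, K p.1 `<=` W.1, K p.2 `<=` W.2 &
      W.1 `&` W.2 = set0].
  move=> [i j] /=; have [_|ij] := eqVneq i j; first by exists (set0, set0).
  have [U [V ?]] := disjoint_compacts_separated (cK i) (cK j) (dK _ _ ij).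
  by exists (U, V).
pose U i := \bigcap_(j in [set j | j != i]) ((W (i, j)).1 `&` (W (j, i)).2).
exists U; split=> [i|i x Kx j /= ji|i j ij].
- rewrite -[U i]setCK; apply: closed_openC; rewrite /U setC_bigcap.
  apply: closed_bigcup => [|j /= ji]; first exact: finite_finset.
  apply: open_closedC; have [|? _ _ _ _] := Wp (i, j); first by rewrite eq_sym.
  by have [_ ? _ _ _] := Wp (j, i) ji; exact: openI.
- have [|_ _ h _ _] := Wp (i, j); first by rewrite eq_sym.
  by have [_ _ _ h' _] := Wp (j, i) ji; split; [exact: h|exact: h'].
- have [_ _ _ _ e] := Wp (i, j) ij.
  apply/seteqP; split=> // x [Ui Uj]; rewrite -e; split.
    by have [] := Ui j; rewrite /= 1?eq_sym.
  by have [] := Uj i.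
Qed.

End CompactSeparation.

(** One half of the tube lemma, with the second factor described by a filter: it
    is used once for the neighbourhoods of a point and once for those of a
    compact set. *)
Lemma tube_filter (X Y : topologicalType) (F : set_system Y)
    (FF : ProperFilter F) (K : set X) (U : set (X * Y)) : compact K ->
  (forall x, K x -> exists A B, [/\ nbhs x A, F B & A `*` B `<=` U]) ->
  exists A B, [/\ set_nbhs K A, F B & A `*` B `<=` U].
Proof.
move=> /compact_near_coveringP cK loc.
pose P (B : set Y) (x : X) := nbhs x [set x' | forall y, B y -> U (x', y)].
have /near_powerset_filter_fromP :
    \forall B \near powerset_filter_from F, K `<=` P B.
  have PF : Filter (powerset_filter_from F).
    by apply: filter_filter; exact: powerset_filter_from_filter.
  apply: (cK _ (powerset_filter_from F) P PF) => x /loc[A [B [xA FB ABU]]].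
  exists (A°, [set B' | F B' /\ B' `<=` B]).
    by split; [exact: nbhs_interior|exact: powerset_filter_fromP].
  move=> [x' B'] [/= Ax' [FB' BB']]; apply: filterS Ax' => x'' Ax'' y B'y.
  by apply: ABU; split => //; exact: BB'.
case=> [B B' BB' h x Kx|B FB h].
  by apply: filterS (h x Kx) => x' h' y By; apply: h'; exact: BB'.
exists [set x' | forall y, B y -> U (x', y)], B; split => //.
by move=> [x y] [/= h' By]; exact: h'.
Qed.

Section ProductTopology.
Context {X Y : topologicalType}.

Lemma hausdorff_prod : hausdorff_space X -> hausdorff_space Y ->
  hausdorff_space (X * Y)%type.
Proof.
move=> hX hY [x y] [x' y'] cl; congr pair.
- apply: hX => A B xA xB.
  have [||[a b] [/= Aa Ba]] := cl (A `*` setT) (B `*` setT).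
  + by exists (A, setT) => //; split => //; exact: filterT.
  + by exists (B, setT) => //; split => //; exact: filterT.
  + by exists a; split; [case: Aa|case: Ba].
- apply: hY => A B yA yB.
  have [||[a b] [/= Aa Ba]] := cl (setT `*` A) (setT `*` B).
  + by exists (setT, A) => //; split => //; exact: filterT.
  + by exists (setT, B) => //; split => //; exact: filterT.
  + by exists b; split; [case: Aa|case: Ba].
Qed.

Lemma tube_lemma (K : set X) (L : set Y) (U : set (X * Y)) :
  compact K -> compact L -> open U -> K `*` L `<=` U ->
  exists A B, [/\ open A, open B, K `<=` A, L `<=` B & A `*` B `<=` U].
Proof.
move=> cK cL oU KLU; have [->|/set0P L0] := eqVneq L set0.
  by exists setT, set0; split=> //; [exact: openT|exact: open0|move=> p []].
have pfL : ProperFilter (set_nbhs L) by exact: set_nbhs_pfilter.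
have [x Kx|A [B [KA LB ABU]]] := @tube_filter _ _ (set_nbhs L) _ K U cK.
  pose U' := [set p : Y * X | U (p.2, p.1)].
  have [y Ly|B [A [LB xA BAU]]] := @tube_filter _ _ (nbhs x) _ L U' cL; last first.
    by exists A, B; split => // -[a b] [/= Aa Bb]; exact: (BAU (b, a)).
  have [[A B] /= [xA yB] ABU] : nbhs (x, y) U.
    by apply: open_nbhs_nbhs; split => //; exact: KLU.
  by exists B, A; split => // -[b a] [/= Bb Aa]; exact: (ABU (a, b)).
move: KA LB => /set_nbhsP[A' [oA' KA' A'A]] /set_nbhsP[B' [oB' LB' B'B]].
exists A', B'; split => // -[a b] [/= A'a B'b]; apply: ABU.
by split; [exact: A'A|exact: B'B].
Qed.

End ProductTopology.

(** * Linear functionals below sublinear ones *)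

Section HahnBanach.
Context {R : realType} {V : lmodType R}.
Variable D : set V.
Hypothesis D_add : forall x y, D x -> D y -> D (x + y).
Hypothesis D_scale : forall (t : R) x, D x -> D (t *: x).

Definition sublinear_on (p : V -> R) :=
  (forall t x, 0 < t -> D x -> p (t *: x) <= t * p x) /\
  (forall x y, D x -> D y -> p (x + y) <= p x + p y).

Let D_opp x : D x -> D (- x). Proof. by rewrite -scaleN1r; exact: D_scale. Qed.

Lemma sublinear0 p : sublinear_on p -> D 0 -> 0 <= p 0.
Proof. by move=> [_ pa] D0; have := pa 0 0 D0 D0; rewrite addr0; lra. Qed.

(** Lower bound common to all sublinear functionals below a given one; it keeps
    the infima below finite. *)
Lemma sublinear_ge p x : sublinear_on p -> D x -> - p (- x) <= p x.
Proof.
move=> sp Dx; have := sp.2 x (- x) Dx (D_opp Dx); rewrite subrr.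
have : D 0 by rewrite -(scale0r x); exact: D_scale.
by move=> /(sublinear0 sp); lra.
Qed.

Lemma sublinear_chain_inf (A : set (V -> R)) (b : V -> R) : A !=set0 ->
  (forall p, A p -> sublinear_on p) ->
  (forall p x, A p -> D x -> b x <= p x) ->
  (forall p p', A p -> A p' -> (forall x, D x -> p x <= p' x) \/
                              (forall x, D x -> p' x <= p x)) ->
  sublinear_on (fun x => inf [set p x | p in A]).
Proof.
move=> [p0 Ap0] sA bA tA.
have lbA x : D x -> has_lbound [set p x | p in A].
  by move=> Dx; exists (b x) => _ [p Ap <-]; exact: bA.
have infP x p : D x -> A p -> inf [set p x | p in A] <= p x.
  by move=> Dx Ap; apply: ge_inf; [exact: lbA|exists p].
split=> [t x t0 Dx|x y Dx Dy].
  rewrite -ler_pdivrMl//; apply: lb_le_inf; first by exists (p0 x), p0.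
  move=> _ [p Ap <-]; rewrite ler_pdivrMl//.
  by apply: le_trans (infP _ _ (D_scale _ Dx) Ap) _; exact: (sA _ Ap).1.
rewrite -lerBlDl; apply: lb_le_inf; first by exists (p0 y), p0.
move=> _ [p Ap <-]; rewrite lerBlDl -lerBlDr.
apply: lb_le_inf; first by exists (p0 x), p0.
move=> _ [p' Ap' <-]; rewrite lerBlDr.
have [pp|pp] := tA _ _ Ap Ap'.
  apply: le_trans (infP _ _ (D_add Dx Dy) Ap) _.
  apply: le_trans ((sA _ Ap).2 _ _ Dx Dy) _.
  by rewrite lerD2r; exact: pp.
apply: le_trans (infP _ _ (D_add Dx Dy) Ap') _.
apply: le_trans ((sA _ Ap').2 _ _ Dx Dy) _.
by rewrite lerD2l; exact: pp.
Qed.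

(** The functional y |-> inf over t >= 0 of p (y + t x) - t p x lies below [p],
    by t = 0, and its value at -x is at most - p x, by t = 1. A minimal [p] is
    therefore odd. *)
Lemma sublinear_lower p x : sublinear_on p -> D x ->
  exists p', [/\ sublinear_on p', forall y, D y -> p' y <= p y &
    p' (- x) <= - p x].
Proof.
move=> sp Dx.
pose S y := [set p (y + t *: x) - t * p x | t in [set t : R | 0 <= t]].
have lbS y : D y -> lbound (S y) (- p (- y)).
  move=> Dy _ [t /= t0 <-].
  have Dyt : D (y + t *: x) by apply: D_add => //; exact: D_scale.
  have h : t * p x <= p (t *: x).
    move: t0; rewrite le_eqVlt => /predU1P[<-|t0].
      rewrite mul0r scale0r; apply: sublinear0 => //.
      by rewrite -(scale0r x); exact: D_scale.
    have := sp.1 t^-1 (t *: x); rewrite invr_gt0 => /(_ t0 (D_scale _ Dx)).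
    by rewrite scalerA mulVf ?gt_eqF// scale1r ler_pdivlMl.
  have := sp.2 _ _ Dyt (D_opp Dy); rewrite addrAC subrr add0r; lra.
have infS y t : D y -> 0 <= t -> inf (S y) <= p (y + t *: x) - t * p x.
  by move=> Dy t0; apply: ge_inf; [exists (- p (- y)); exact: lbS|exists t].
have S0 y : S y !=set0 by exists (p (y + 0 *: x) - 0 * p x); exists 0 => /=.
exists (fun y => inf (S y)); split; last first.
- have := infS _ 1 (D_opp Dx) ler01.
  rewrite scale1r mul1r addNr => /le_trans; apply.
  have D0 : D 0 by rewrite -(scale0r x); exact: D_scale.
  have := sp.1 2 0 (ltr0n _ 2) D0; rewrite scaler0.
  have := sublinear0 sp D0.
  suff : p 0 <= 0 by lra.
  have := sp.1 (2^-1) 0 _ D0; rewrite scaler0 invr_gt0 => /(_ (ltr0n _ 2)).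
  lra.
- by move=> y Dy; have := infS y 0 Dy (lexx 0); rewrite scale0r addr0 mul0r subr0.
- split=> [t y t0 Dy|y z Dy Dz].
    rewrite -ler_pdivrMl//; apply: lb_le_inf => // _ [s /= s0 <-].
    rewrite ler_pdivrMl//.
    have ts0 : 0 <= t * s by rewrite mulr_ge0// ltW.
    apply: le_trans (infS _ _ (D_scale _ Dy) ts0) _.
    rewrite -scalerA -scalerDr mulrBr mulrA lerD2r.
    by apply: sp.1 => //; apply: D_add => //; exact: D_scale.
  rewrite -lerBlDl; apply: lb_le_inf => // _ [s /= s0 <-].
  rewrite lerBlDl -lerBlDr; apply: lb_le_inf => // _ [t /= t0 <-].
  rewrite lerBlDr; apply: le_trans (infS _ _ (D_add Dy Dz) (addr_ge0 t0 s0)) _.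
  rewrite scalerDl addrACA.
  have Dt : D (y + t *: x) by apply: D_add => //; exact: D_scale.
  have Ds : D (z + s *: x) by apply: D_add => //; exact: D_scale.
  by have := sp.2 _ _ Dt Ds; lra.
Qed.

(** A minimal element among the sublinear functionals below [q] is odd, hence
    additive; Zorn's lemma applies because chains have infima. Working with
    minimal functionals avoids partial extensions and their domains. The domain
    [D] is a subspace given as a set, so that [V] can be a space of functions
    and [D] the bounded ones. *)
Theorem hahn_banach_dominated (q : V -> R) : sublinear_on q ->
  exists f : V -> R, [/\ forall x y, D x -> D y -> f (x + y) = f x + f y,
    forall t x, D x -> f (t *: x) = t * f x & forall x, D x -> f x <= q x].
Proof.
move=> sq.
pose Sub := {p : V -> R | sublinear_on p /\ forall x, D x -> p x <= q x}.
pose Rl (p p' : Sub) := `[< forall x, D x -> sval p' x <= sval p x >].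
have [|||[p [sp pq]] pmin] :=
  @ZL_preorder Sub (exist _ q (conj sq (fun _ _ => lexx _))) Rl.
- by move=> t; apply/asboolP.
- move=> r s t /asboolP rs /asboolP st; apply/asboolP => x Dx.
  exact: le_trans (st _ Dx) (rs _ Dx).
- move=> A tA; have [[s0 As0]|A0] := pselect (A !=set0); last first.
    exists (exist _ q (conj sq (fun _ _ => lexx _))) => s As.
    by exfalso; apply: A0; exists s.
  pose B := [set sval s | s in A].
  have lb p x : B p -> D x -> - q (- x) <= p x.
    move=> [s As <-] Dx; apply: le_trans (sublinear_ge (proj2_sig s).1 Dx).
    by rewrite lerN2; apply: (proj2_sig s).2; exact: D_opp.
  have sm : sublinear_on (fun x => inf [set p x | p in B]).
    apply: (@sublinear_chain_inf B (fun x => - q (- x))) => //.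
    - by exists (sval s0), s0.
    - by move=> _ [s As <-]; exact: (proj2_sig s).1.
    - move=> _ _ [s As <-] [s' As' <-].
      by have [/asboolP|/asboolP] := tA _ _ As As'; [right|left].
  have mle s x : A s -> D x -> inf [set p x | p in B] <= sval s x.
    move=> As Dx; apply: ge_inf; last by exists (sval s) => //; exists s.
    by exists (- q (- x)) => _ [p Bp <-]; exact: lb.
  have mq x : D x -> inf [set p x | p in B] <= q x.
    by move=> Dx; apply: le_trans (mle _ _ As0 Dx) _; exact: (proj2_sig s0).2.
  exists (exist _ (fun x => inf [set p x | p in B]) (conj sm mq)) => s As.
  by apply/asboolP => x Dx /=; exact: mle.
have pN x : D x -> p (- x) = - p x.
  move=> Dx; have [p' [sp' p'p p'x]] := sublinear_lower sp Dx.
  have p'q y : D y -> p' y <= q y.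
    by move=> Dy; apply: le_trans (p'p _ Dy) _; exact (pq _ Dy).
  have := pmin (exist _ p' (conj sp' p'q)); rewrite /Rl/=.
  move=> /(_ (introT (asboolP _) p'p)) /asboolP/(_ _ (D_opp Dx))/= h.
  by have := sublinear_ge sp Dx; lra.
have pD x y : D x -> D y -> p (x + y) = p x + p y.
  move=> Dx Dy; have := sp.2 _ _ Dx Dy.
  have := sp.2 _ _ (D_add Dx Dy) (D_opp Dy); rewrite addrK pN//; lra.
have pZ t x : 0 < t -> D x -> p (t *: x) = t * p x.
  move=> t0 Dx; have := sp.1 _ _ t0 Dx.
  have := sp.1 _ _ t0 (D_opp Dx); rewrite scalerN !pN//; last exact: D_scale.
  lra.
exists p; split => // t x Dx; have [t0|t0|->] := ltgtP t 0.
- by rewrite -[t]opprK scaleNr pN ?pZ ?oppr_gt0 ?mulNr//; exact: D_scale.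
- exact: pZ.
- rewrite scale0r mul0r -[0](subrr x) pD ?pN ?subrr//; exact: D_opp.
Qed.

End HahnBanach.

(** The sublinear functional is the infimum of [S x]. Its values are not explicit,
    those in [S x] are, so the hypotheses bear on [S]. *)
Section ConeFunctional.
Context {R : realType} {V : lmodType R}.
Variable D : set V.
Hypothesis D_add : forall x y, D x -> D y -> D (x + y).
Hypothesis D_scale : forall (t : R) x, D x -> D (t *: x).
Variable S : V -> set R.
Hypothesis S_nonempty : forall x, D x -> S x !=set0.
Hypothesis S_scale : forall t x r, 0 < t -> D x -> S x r -> S (t *: x) (t * r).
Hypothesis S_add : forall x y r s, D x -> D y -> S x r -> S y s ->
  exists2 u, S (x + y) u & u <= r + s.
Hypothesis S_ge0 : forall r, S 0 r -> 0 <= r.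

Lemma cone_functional : exists f : V -> R,
  [/\ forall x y, D x -> D y -> f (x + y) = f x + f y,
    forall t x, D x -> f (t *: x) = t * f x & forall x r, D x -> S x r -> f x <= r].
Proof.
have lbS x : D x -> has_lbound (S x).
  move=> Dx; have DNx : D (- x) by rewrite -scaleN1r; exact: D_scale.
  have [s Ss] := S_nonempty DNx; exists (- s) => r Sr.
  have [u] := S_add Dx DNx Sr Ss; rewrite subrr => /S_ge0; lra.
have infS x r : D x -> S x r -> inf (S x) <= r.
  by move=> Dx Sr; apply: ge_inf => //; exact: lbS.
have [|f [fD fZ fq]] := hahn_banach_dominated D_add D_scale (q := inf \o S).
  split=> [t x t0 Dx|x y Dx Dy] /=.
    rewrite -ler_pdivrMl//; apply: lb_le_inf; first exact: S_nonempty.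
    move=> r Sr; rewrite ler_pdivrMl//; apply: infS; first exact: D_scale.
    exact: S_scale.
  rewrite -lerBlDl; apply: lb_le_inf; first exact: S_nonempty.
  move=> s Ss; rewrite lerBlDl -lerBlDr; apply: lb_le_inf; first exact: S_nonempty.
  move=> r Sr; rewrite lerBlDr; have [u Su] := S_add Dx Dy Sr Ss.
  by apply: le_trans; apply: infS => //; exact: D_add.
by exists f; split => // x r Dx Sr; apply: le_trans (fq _ Dx) _; exact: infS.
Qed.

End ConeFunctional.

(** * Radon regularisation of finitely additive set functions *)

Local Open Scope ereal_scope.

Section Regularisation.
Context {R : realType} {X : ptopologicalType}.
Hypothesis hX : hausdorff_space X.
Variable lam : set X -> R.
Hypothesis lam_ge0 : forall A, (0 <= lam A)%R.
Hypothesis lamU : forall A B, A `&` B = set0 ->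
  lam (A `|` B) = (lam A + lam B)%R.

Lemma lam_mono A B : A `<=` B -> (lam A <= lam B)%R.
Proof.
by move=> AB; rewrite -[in leRHS](setDUK AB) lamU ?lerDl// setDIK.
Qed.

Lemma lam_subU A B : (lam (A `|` B) <= lam A + lam B)%R.
Proof.
have -> : A `|` B = A `|` (B `\` A).
  by apply/seteqP; split => x [?|]; have [?|?] := pselect (A x); try (by left);
    [move=> ?; right|case=> ? _; right].
rewrite lamU ?setDIK// lerD2l; by apply: lam_mono => x [].
Qed.

(** A finitely additive [lam] can be much smaller on a compact set than on all
    neighbourhoods of it, so the regularisation reads [lam] on open sets only:
    from above on compact sets, from there below on open sets, and again from
    above on all sets. *)
Definition outer_content (K : set X) : \bar R :=
  ereal_inf [set (lam G)%:E | G in [set G | open G /\ K `<=` G]].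

Definition open_content (G : set X) : \bar R :=
  ereal_sup [set outer_content K | K in [set K | compact K /\ K `<=` G]].

Definition regular_outer (A : set X) : \bar R :=
  ereal_inf [set open_content G | G in [set G | open G /\ A `<=` G]].

Lemma outer_content_ge0 K : 0 <= outer_content K.
Proof. by apply: le_ereal_inf_tmp => _ [G _ <-]; rewrite lee_fin. Qed.

Lemma outer_content_le K G : open G -> K `<=` G -> outer_content K <= (lam G)%:E.
Proof. by move=> oG KG; apply: ereal_inf_lbound; exists G. Qed.

Lemma outer_content_fin K : outer_content K \is a fin_num.
Proof.
rewrite ge0_fin_numE ?outer_content_ge0//.
by rewrite (le_lt_trans (outer_content_le openT (@subsetT _ K)))// ltry.
Qed.

Lemma outer_contentU K L :
  outer_content (K `|` L) <= outer_content K + outer_content L.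
Proof.
apply/lee_addgt0Pr => e e0.
have e20 : (0 < e / 2)%R by rewrite divr_gt0.
have [_ [G [oG KG] <-] Ge] := lb_ereal_inf_adherent e20 (outer_content_fin K).
have [_ [H [oH LH] <-] He] := lb_ereal_inf_adherent e20 (outer_content_fin L).
rewrite [in leRHS](splitr e) EFinD addeACA.
apply: le_trans (leeD (ltW Ge) (ltW He)).
rewrite -EFinD; apply: le_trans (_ : (lam (G `|` H))%:E <= _).
  by apply: outer_content_le; [exact: openU|exact: setUSS].
by rewrite lee_fin lam_subU.
Qed.

(** Disjoint compact sets have disjoint open neighbourhoods, on which [lam] is
    additive; the additivity of the regularisation comes from here. *)
Lemma outer_contentU_disjoint K L : compact K -> compact L -> K `&` L = set0 ->
  outer_content K + outer_content L <= outer_content (K `|` L).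
Proof.
move=> cK cL KL; apply: le_ereal_inf_tmp => _ [G [oG KLG] <-].
have [U [V [oU oV KU LV UV]]] := disjoint_compacts_separated hX cK cL KL.
apply: le_trans (_ : (lam (G `&` U))%:E + (lam (G `&` V))%:E <= _).
  apply: leeD; apply: outer_content_le; [exact: openI| |exact: openI|].
  - by move=> x Kx; split; [apply: KLG; left|exact: KU].
  - by move=> x Kx; split; [apply: KLG; right|exact: LV].
rewrite -EFinD lee_fin -lamU; first by apply: lam_mono => x [[]|[]].
by rewrite setIACA UV setI0.
Qed.

Lemma open_content_ge0 G : 0 <= open_content G.
Proof.
apply: le_ereal_sup_tmp; exists (outer_content set0); last exact: outer_content_ge0.
by exists set0 => //; split => //; exact: compact0.
Qed.

Lemma open_content_le G : open G -> open_content G <= (lam G)%:E.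
Proof.
by move=> oG; apply: ge_ereal_sup => _ [K [cK KG] <-]; exact: outer_content_le.
Qed.

Lemma outer_le_open_content K G : compact K -> K `<=` G ->
  outer_content K <= open_content G.
Proof. by move=> cK KG; apply: ereal_sup_ubound; exists K. Qed.

Lemma le_open_content G H : G `<=` H -> open_content G <= open_content H.
Proof.
move=> GH; apply: ge_ereal_sup => _ [K [cK KG] <-].
by apply: outer_le_open_content => //; exact: subset_trans GH.
Qed.

Lemma open_content0 : open_content set0 = 0.
Proof.
apply/eqP; rewrite eq_le open_content_ge0 andbT.
rewrite (le_trans (open_content_le open0))// lee_fin.
have := lamU (@setI0 _ set0); rewrite setU0 => h.
by have := lam_ge0 set0; lra.
Qed.

(** A compact subset of the union is covered by finitely many of the open sets
    and splits accordingly. *)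
Lemma open_content_bigcup (G : (set X)^nat) : (forall n, open (G n)) ->
  open_content (\bigcup_n G n) <= \sum_(n <oo) open_content (G n).
Proof.
move=> oG; apply: ge_ereal_sup => _ [K [cK KG] <-].
have [n Kn] : exists n, K `<=` \big[setU/set0]_(i < n) G i.
  move/compact_near_coveringP : (cK) => /(_ nat \oo
      (fun n => (\big[setU/set0]_(i < n) G i)) _).
  have cover x : K x ->
      \forall x' \near x & i \near \oo, (\big[setU/set0]_(i0 < i) G i0) x'.
    move=> /KG[m _ Gx]; exists (G m, [set k | (m < k)%N]).
      by split => /=; [apply: open_nbhs_nbhs; split|exists m.+1].
    move=> [y k] [/= Gy mk]; rewrite -bigcup_mkord; exists m => //.
  by move=> /(_ cover)[n _ /(_ n (leqnn n))]; exists n.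
have {}Kn : outer_content K <= \sum_(i < n) open_content (G i).
  elim: n K cK {KG} Kn => [|n ih] K cK.
    rewrite !big_ord0 => K0; apply: le_trans (outer_content_le open0 K0) _.
    have := lamU (@setI0 _ set0); rewrite setU0 => h.
    by have := lam_ge0 set0; rewrite lee_fin; lra.
  rewrite !big_ord_recr/= => Kn.
  have [||K1 [K2 [cK1 cK2 K1G K2G ->]]] := compact_split hX cK _ _ Kn.
  - by rewrite -bigcup_mkord; exact: bigcup_open.
  - exact: oG.
  - apply: le_trans (outer_contentU _ _) _.
    by apply: leeD; [exact: ih|exact: outer_le_open_content].
apply: le_trans Kn _.
rewrite -(big_mkord xpredT (open_content \o G)).
by apply: nneseries_lim_ge => i _ _; exact: open_content_ge0.
Qed.

Lemma regular_outer_open G : open G -> regular_outer G = open_content G.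
Proof.
move=> oG; apply/eqP; rewrite eq_le; apply/andP; split.
  by apply: ereal_inf_lbound; exists G => //; split.
by apply: le_ereal_inf_tmp => _ [H [oH GH] <-]; exact: le_open_content.
Qed.

Lemma regular_outer_ge0 A : 0 <= regular_outer A.
Proof. by apply: le_ereal_inf_tmp => _ [G _ <-]; exact: open_content_ge0. Qed.

Lemma regular_outer_le A B : A `<=` B -> regular_outer A <= regular_outer B.
Proof.
move=> AB; apply: ereal_inf_le_tmp => _ [G [oG BG] <-]; exists G => //.
by split=> //; exact: subset_trans BG.
Qed.

Lemma regular_outer_fin A : regular_outer A \is a fin_num.
Proof.
rewrite ge0_fin_numE ?regular_outer_ge0//.
rewrite (le_lt_trans (regular_outer_le (@subsetT _ A)))//.
by rewrite regular_outer_open ?(le_lt_trans (open_content_le _)) ?ltry//; exact: openT.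
Qed.

Lemma regular_outer0 : regular_outer set0 = 0.
Proof. by rewrite regular_outer_open ?open_content0//; exact: open0. Qed.

Lemma regular_outer_sigma_subadditive : sigma_subadditive regular_outer.
Proof.
move=> A; apply/lee_addgt0Pr => e e0.
rewrite (le_trans _ (epsilon_trick _ _ (ltW e0)))//; last first.
  by move=> n; exact: regular_outer_ge0.
have /choice[G Gp] : forall n, exists G, [/\ open G, A n `<=` G &
    open_content G <= regular_outer (A n) + (e / (2 ^ n.+1)%:R)%:E].
  move=> n; have en : (0 < e / (2 ^ n.+1)%:R)%R.
    by rewrite divr_gt0// ltr0n expn_gt0.
  have [_ [G [oG AG] <-] /ltW Ge] :=
    lb_ereal_inf_adherent en (regular_outer_fin (A n)).
  by exists G.
have oG n : open (G n) by have [] := Gp n.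
apply: le_trans (_ : open_content (\bigcup_n G n) <= _).
  rewrite -regular_outer_open; last exact: bigcup_open.
  by apply: regular_outer_le; apply: subset_bigcup => n _; have [] := Gp n.
apply: le_trans (open_content_bigcup oG) _.
apply: lee_nneseries => [n _ _|n _]; first exact: open_content_ge0.
by have [] := Gp n.
Qed.

HB.instance Definition _ := isOuterMeasure.Build R X regular_outer
  regular_outer0 regular_outer_ge0 regular_outer_le
  regular_outer_sigma_subadditive.

(** It suffices to split an open set [H]: exhaust H :&: G by a compact [K], then
    the open set H :\: K, which contains H :\: G, by a compact [L]. *)
Lemma open_caratheodory G : open G -> regular_outer.-caratheodory G.
Proof.
move=> oG; apply: le_caratheodory_measurable => A.
apply: le_ereal_inf_tmp => _ [H [oH AH] <-].
apply: le_trans (_ : regular_outer (H `&` G) + regular_outer (H `&` ~` G) <= _).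
  by apply: leeD; apply: regular_outer_le; exact: setSI.
rewrite regular_outer_open; last exact: openI.
rewrite -leeBrDr ?regular_outer_fin//; apply: ge_ereal_sup => _ [K [cK KHG] <-].
rewrite leeBrDr ?regular_outer_fin// addeC -leeBrDr ?outer_content_fin//.
have clK : closed K by exact: compact_closed.
apply: le_trans (_ : open_content (H `&` ~` K) <= _).
  rewrite -regular_outer_open; last by apply: openI => //; exact: closed_openC.
  apply: regular_outer_le; apply: setIS => x nGx Kx.
  by apply: nGx; have [] := KHG x Kx.
apply: ge_ereal_sup => _ [L [cL LHK] <-].
rewrite leeBrDr ?outer_content_fin// addeC.
have KL : K `&` L = set0.
  by apply/seteqP; split => // x [Kx Lx]; have [_] := LHK _ Lx.
apply: le_trans (outer_contentU_disjoint cK cL KL) _.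
apply: outer_le_open_content; first exact: compactU.
by move=> x [/KHG[]|/LHK[]].
Qed.

Lemma borel_caratheodory (A : set (borelType X)) : measurable A ->
  regular_outer.-caratheodory A.
Proof.
move=> mA.
have : <<s [set B : set X | regular_outer.-caratheodory B] >> `<=`
    [set B : set X | regular_outer.-caratheodory B].
  apply: smallest_sub => //; split.
  - exact: caratheodory_measurable_set0.
  - by move=> B cB; rewrite setTD; exact: caratheodory_measurable_setC.
  - by move=> F cF; exact: caratheodory_measurable_bigcup.
apply; move: mA; apply: sub_sigma_algebra2 => B /= oB; exact: open_caratheodory.
Qed.

Lemma regular_outer_sigma_additive :
  semi_sigma_additive (regular_outer : set (borelType X) -> \bar R).
Proof.
move=> A mA tA _.
have mC n : regular_outer.-cara.-measurable (A n) by exact: borel_caratheodory.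
apply: (@caratheodory_measure_sigma_additive R X regular_outer A mC tA).
exact: caratheodory_measurable_bigcup.
Qed.

(* Typed over [borelType X] so as to receive the structure of a measure. *)
Let regular_measure : set (borelType X) -> \bar R := regular_outer.

HB.instance Definition _ := isMeasure.Build _ (borelType X) R regular_measure
  regular_outer0 regular_outer_ge0 regular_outer_sigma_additive.

HB.instance Definition _ := Measure_isFinite.Build _ (borelType X) R
  regular_measure (fun A _ => regular_outer_fin A).

Lemma regular_outer_compact K : compact K -> regular_outer K = outer_content K.
Proof.
move=> cK; apply/eqP; rewrite eq_le; apply/andP; split.
  apply: le_ereal_inf_tmp => _ [G [oG KG] <-].
  by apply: le_trans (open_content_le oG); apply: ereal_inf_lbound; exists G.
by apply: le_ereal_inf_tmp => _ [G [oG KG] <-]; exact: outer_le_open_content.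
Qed.

(** The tightness hypothesis is stated with open neighbourhoods of the compact
    set, not with the compact set itself, because [lam] of a compact set carries
    no information; it is exactly what makes the total masses agree. *)
Lemma radon_regularisation :
  (forall e : R, (0 < e)%R -> exists2 K, compact K & forall U, open U ->
     K `<=` U -> (lam (~` U) <= e)%R) ->
  exists gamma : {borel_measure X -> R}, [/\ radon gamma,
    forall G, open G -> gamma G <= (lam G)%:E & gamma setT = (lam setT)%:E].
Proof.
move=> tight; exists (regular_measure : {borel_measure X -> R}).
have rcompact K : compact K -> measurable (K : set (borelType X)).
  move=> /(compact_closed hX) cK; rewrite -[K]setCK; apply: measurableC.
  by apply: sub_sigma_algebra; exact: closed_openC.
split.
- move=> B mB; apply/eqP; rewrite eq_le; apply/andP; split; last first.
    by apply: ge_ereal_sup => _ [K [cK KB] <-]; exact: regular_outer_le.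
  apply/lee_addgt0Pr => e e0.
  have e20 : (0 < e / 2)%R by rewrite divr_gt0.
  have [_ [G [oG BG] <-] Ge] :=
    lb_ereal_inf_adherent e20 (regular_outer_fin (~` B)).
  have [_ [K [cK _] <-] Ke] : exists2 x,
     [set outer_content K | K in [set K | compact K /\ K `<=` setT]] x &
     open_content setT - (e / 2)%:E < x.
    apply: ub_ereal_sup_adherent => //.
    by have := regular_outer_fin setT; rewrite regular_outer_open//; exact: openT.
  (* [G] almost carries the complement of [B] and [K] almost all the mass, so
     [K] minus [G] is almost all of [B]. *)
  have cKG : compact (K `&` ~` G).
    by apply: compact_closedI => //; exact: open_closedC.
  apply: le_trans (_ : regular_measure (K `&` ~` G) + e%:E <= _); last first.
    rewrite leeD2r//; apply: ereal_sup_ubound; exists (K `&` ~` G) => //.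
    by split => // x [_ nG]; apply: contrapT => nB; apply: nG; exact: BG.
  have mG : measurable (G : set (borelType X)) by exact: sub_sigma_algebra.
  have fin (A : set X) : regular_measure A \is a fin_num := regular_outer_fin A.
  have h1 : regular_measure setT = regular_measure B + regular_measure (~` B).
    by rewrite -measureU ?setUv ?setICr//; exact: measurableC.
  have h2 : regular_measure K =
      regular_measure (K `&` G) + regular_measure (K `&` ~` G).
    rewrite -measureU -?setIUr ?setUv ?setIT//; try exact: rcompact.
      by apply: measurableI => //; exact: rcompact.
    by rewrite setIACA setICr setI0.
  have h3 : regular_measure (K `&` G) <= regular_measure G.
    exact: regular_outer_le.
  move: Ke; rewrite -(regular_outer_compact cK).
  rewrite -regular_outer_open; last exact: openT.
  move: Ge; rewrite -(regular_outer_open oG) => Ge Ke.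
  move: h1 h2 h3 Ge Ke; change (regular_outer) with regular_measure.
  change (regular_measure setT = regular_measure B + regular_measure (~` B) ->
    regular_measure K = regular_measure (K `&` G) + regular_measure (K `&` ~` G) ->
    regular_measure (K `&` G) <= regular_measure G ->
    regular_measure G < regular_measure (~` B) + (e / 2)%:E ->
    regular_measure setT - (e / 2)%:E < regular_measure K ->
    regular_measure B <= regular_measure (K `&` ~` G) + e%:E).
  move: (fin setT) (fin B) (fin (~` B)) (fin K).
  move: (fin (K `&` G)) (fin (K `&` ~` G)) (fin G).
  case: (regular_measure setT) => // t; case: (regular_measure B) => // b.
  case: (regular_measure (~` B)) => // b'; case: (regular_measure K) => // k.
  case: (regular_measure (K `&` G)) => // kg.
  case: (regular_measure (K `&` ~` G)) => // kg'.
  case: (regular_measure G) => // g _ _ _ _ _ _ _.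
  by rewrite -!EFinD => -[h1] [h2]; rewrite !lee_fin !lte_fin; lra.
- move=> G oG; change (regular_outer G <= (lam G)%:E).
  by rewrite regular_outer_open// open_content_le.
- change (regular_outer setT = (lam setT)%:E).
  rewrite regular_outer_open; last exact: openT.
  apply/eqP; rewrite eq_le open_content_le/=; last exact: openT.
  apply/lee_addgt0Pr => e e0; have [K cK KU] := tight e e0.
  apply: le_trans (_ : outer_content K + e%:E <= _); last first.
    by rewrite leeD2r//; exact: outer_le_open_content.
  rewrite -leeBlDr//; apply: le_ereal_inf_tmp => _ [G [oG KG] <-].
  have := KU G oG KG; rewrite -EFinB lee_fin.
  by have := lamU (setICr G); rewrite setUv; lra.
Qed.

End Regularisation.

(** * Concave conjugates and affine minorants *)

Section ConcaveConjugate.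
Context {R : realType}.
Implicit Types (F : R -> \bar R) (a b s r : R).

(** F°(a) >= b says that s |-> b - a s is an affine minorant of [F]; all
    properties of F° below are read off this equivalence. *)
Lemma Fcirc_geP F a b :
  b%:E <= Fcirc F a <-> forall s, (0 <= s)%R -> (b - a * s)%:E <= F s.
Proof.
rewrite /Fcirc /legendre leeNr; split.
- move=> /ereal_supP h s s0.
  have Ss : [set (s * - a)%:E - F s | s in `[0%R, +oo[ ] ((s * - a)%:E - F s).
    by exists s; rewrite //= in_itv/= s0.
  have {h Ss} := h _ Ss; case: (F s) => [x||]; rewrite ?leey// ?leNye//.
  by rewrite -EFinN -EFinB !lee_fin; lra.
- move=> h; apply/ereal_supP => y [s /=]; rewrite in_itv/= andbT => s0 <-{y}.
  have := h s s0; case: (F s) => [x||]; rewrite ?leey ?leNye//.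
  by rewrite -EFinN -EFinB !lee_fin; lra.
Qed.

Section GammaF.
Variable F : R -> \bar R.
Hypothesis GF : Gamma F.

Lemma Gamma_dom : exists s v, [/\ (0 < s)%R, (0 <= v)%R & F s = v%:E].
Proof.
have [s [[s0 Fs] /=]] := Gamma_proper GF; rewrite in_itv/= andbT => s0'.
exists s, (fine (F s)); split => //; first by rewrite fine_ge0// Gamma_ge0.
by rewrite fineK// ge0_fin_numE// Gamma_ge0.
Qed.

Lemma Fcirc_lty a : Fcirc F a < +oo.
Proof.
have [s [v [s0 v0 Fs]]] := Gamma_dom.
rewrite ltNge; apply/negP => /(le_trans (leey (v + a * s + 1)%:E)) /Fcirc_geP.
by move=> /(_ s (ltW s0)); rewrite Fs lee_fin; lra.
Qed.

Lemma Fcirc_finP a :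
  Fcirc F a \is a fin_num <-> exists b, forall s, (0 <= s)%R -> (b - a * s)%:E <= F s.
Proof.
split.
  by move=> /fineK e; exists (fine (Fcirc F a)); apply/Fcirc_geP; rewrite e.
move=> [b /Fcirc_geP h]; rewrite fin_numE; apply/andP; split.
  by rewrite -ltNye; exact: lt_le_trans (ltNyr b) h.
by rewrite lt_eqF// Fcirc_lty.
Qed.

(** F° never takes the value +oo, so only its finite values matter; they are
    used as real numbers to make the duality arguments real-valued. *)
Definition Fcirc_real a : R := fine (Fcirc F a).

Lemma Fcirc_realE a : Fcirc F a \is a fin_num -> Fcirc F a = (Fcirc_real a)%:E.
Proof. by move=> /fineK <-. Qed.

Lemma Fcirc_real_ge a b : (forall s, (0 <= s)%R -> (b - a * s)%:E <= F s) ->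
  (b <= Fcirc_real a)%R.
Proof.
move=> h; have /Fcirc_realE e : Fcirc F a \is a fin_num by apply/Fcirc_finP; exists b.
by rewrite -lee_fin -e; apply/Fcirc_geP.
Qed.

Lemma Fcirc_real_le a s : Fcirc F a \is a fin_num -> (0 <= s)%R ->
  (Fcirc_real a - a * s)%:E <= F s.
Proof. by move=> /Fcirc_realE e s0; move: s s0; apply/Fcirc_geP; rewrite e. Qed.

(** F° is nondecreasing because slopes act on s >= 0 only. *)
Lemma Fcirc_fin_le a a' : (a <= a')%R -> Fcirc F a \is a fin_num ->
  Fcirc F a' \is a fin_num /\ (Fcirc_real a <= Fcirc_real a')%R.
Proof.
move=> aa fa.
have h s : (0 <= s)%R -> (Fcirc_real a - a' * s)%:E <= F s.
  move=> s0; apply: le_trans (Fcirc_real_le fa s0); rewrite lee_fin.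
  by have := ler_wpM2r s0 aa; lra.
by split; [apply/Fcirc_finP; exists (Fcirc_real a)|exact: Fcirc_real_ge].
Qed.

(** Since [F] is nonnegative, the value of F° at 0 is inf F >= 0. *)
Lemma Fcirc0_fin a : (0 <= a)%R -> Fcirc F a \is a fin_num /\ (0 <= Fcirc_real a)%R.
Proof.
move=> a0; have h s : (0 <= s)%R -> (0 - a * s)%:E <= F s.
  move=> s0; apply: le_trans (Gamma_ge0 GF s0); rewrite lee_fin.
  by have := mulr_ge0 a0 s0; lra.
by split; [apply/Fcirc_finP; exists 0%R|exact: Fcirc_real_ge].
Qed.

Lemma Fcirc_concave a b t : (0 <= t <= 1)%R ->
  Fcirc F a \is a fin_num -> Fcirc F b \is a fin_num ->
  Fcirc F (t * a + (1 - t) * b)%R \is a fin_num /\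
  (t * Fcirc_real a + (1 - t) * Fcirc_real b <=
   Fcirc_real (t * a + (1 - t) * b))%R.
Proof.
move=> /andP[t0 t1] fa fb.
have h s : (0 <= s)%R -> ((t * Fcirc_real a + (1 - t) * Fcirc_real b) -
    (t * a + (1 - t) * b) * s)%:E <= F s.
  move=> s0; have := Fcirc_real_le fa s0; have := Fcirc_real_le fb s0.
  case: (F s) => [x||]; rewrite ?leey// !lee_fin => hb ha.
  have h1 := ler_wpM2l t0 ha; have t1' : (0 <= 1 - t)%R by lra.
  by have h2 := ler_wpM2l t1' hb; lra.
by split; [apply/Fcirc_finP; eexists; exact: h|exact: Fcirc_real_ge].
Qed.

Lemma Gamma_lsc_at s0 r : (0 <= s0)%R -> r%:E < F s0 -> exists2 d : R,
  (0 < d)%R & forall s, (0 <= s)%R -> (`|s - s0| < d)%R -> r%:E < F s.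
Proof.
move=> s00 rF; have [V] := Gamma_lsc GF (rF : r%:E < F (s0 : subspace `[0%R, +oo[)).
have -> : nbhs (s0 : subspace `[0%R, +oo[) =
  nbhs_subspace (s0 : subspace `[0%R, +oo[) by [].
rewrite -nbhs_subspace_in/=; last by rewrite in_itv/= s00.
move=> /nbhs_ballP[d /= d0 dV] VF; exists d => // s s0' sd.
by apply: VF; apply: dV; [rewrite /ball/= distrC|rewrite /= in_itv/= s0'].
Qed.

(** A point strictly below the graph is separated from the epigraph by a line
    whose slope is the supremum of the slopes from that point to the graph on
    its left. Convexity bounds these by the slopes on the right; lower
    semicontinuity keeps them finite near [s0]. *)
Lemma affine_minorant s0 r : (0 <= s0)%R -> r%:E < F s0 ->
  exists k, forall s, (0 <= s)%R -> (r + k * (s - s0))%:E <= F s.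
Proof.
move=> s00 rF; have [r0|r0] := leP r 0%R.
  exists 0%R => s s0'; rewrite mul0r addr0.
  by apply: le_trans (Gamma_ge0 GF s0'); rewrite lee_fin.
have [d d0 dF] := Gamma_lsc_at s00 rF.
(* The value - (r / d) keeps [S] nonempty when s0 = 0, and is below every slope
   on the right because F >= 0, and F > r within distance [d] of [s0]. *)
pose S := [set k : R | k = (- (r / d))%R \/ exists s v, [/\ (0 <= s)%R, (s < s0)%R,
  F s = v%:E & k = ((r - v) / (s0 - s))%R]].
have S_le t w k : (s0 < t)%R -> F t = w%:E -> S k -> (k <= (w - r) / (t - s0))%R.
  move=> st Ft [->|[s [v [s0' ss0 Fs ->]]]].
    have ts : (0 < t - s0)%R by lra.
    rewrite ler_pdivlMr//; have w0 : (0 <= w)%R.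
      by rewrite -lee_fin -Ft; apply: (Gamma_ge0 GF); lra.
    have [td|td] := ltP (t - s0)%R d.
      have : r%:E < F t.
        by apply: dF; [lra|rewrite gtr0_norm].
      rewrite Ft lte_fin => rw.
      have := divr_gt0 r0 d0; have := ts; nra.
    have : (r / d * (t - s0) >= r)%R.
      by rewrite mulrAC ler_pdivlMr// ler_pM2l.
    lra.
  have ss : (0 < s0 - s)%R by lra.
  have ts : (0 < t - s0)%R by lra.
  rewrite ler_pdivlMr// mulrAC ler_pdivrMr//.
  pose l := ((t - s0) / (t - s))%R.
  have tts : (t - s != 0)%R by rewrite gt_eqF//; lra.
  have l01 : (0 <= l <= 1)%R.
    by rewrite divr_ge0 ?ler_pdivrMr/=; lra.
  have t0 : (0 <= t)%R by lra.
  have := Gamma_convex GF s0' t0 l01.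
  have -> : (l * s + (1 - l) * t = s0)%R by rewrite /l; field.
  rewrite Fs Ft => /(lt_le_trans rF); rewrite -!EFinM -EFinD lte_fin => h.
  have tts' : (0 < t - s)%R by lra.
  have := ltW h; rewrite -(ler_pM2r tts').
  have -> : ((l * v + (1 - l) * w) * (t - s) = (t - s0) * v + (s0 - s) * w)%R.
    by rewrite /l; field.
  lra.
have S_ub k : S k -> (k <= r / d)%R.
  have rd : (0 < r / d)%R by exact: divr_gt0.
  move=> [->|[s [v [s0' ss0 Fs ->]]]]; first lra.
  have ss : (0 < s0 - s)%R by lra.
  rewrite ler_pdivrMr//.
  have v0 : (0 <= v)%R by rewrite -lee_fin -Fs; exact: (Gamma_ge0 GF).
  have [sd|sd] := ltP (s0 - s)%R d.
    have : r%:E < F s by apply: dF => //; rewrite distrC gtr0_norm.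
    rewrite Fs lte_fin => rv; nra.
  have : (r / d * (s0 - s) >= r)%R by rewrite mulrAC ler_pdivlMr// ler_pM2l.
  lra.
have S0 : S (- (r / d))%R by left.
have Ssup : has_ubound S by exists (r / d)%R.
exists (sup S) => s s0'.
case Fs : (F s) => [v||]; rewrite ?leey//; last first.
  by have := Gamma_ge0 GF s0'; rewrite Fs.
rewrite lee_fin; have [ss|ss|ss] := ltgtP s s0.
- have ss' : (0 < s0 - s)%R by lra.
  have : ((r - v) / (s0 - s) <= sup S)%R.
    by apply: ub_le_sup => //; right; exists s, v.
  by rewrite ler_pdivrMr//; lra.
- have ss' : (0 < s - s0)%R by lra.
  have : (sup S <= (v - r) / (s - s0))%R.
    by apply: ge_sup => [|k]; [exists (- (r / d))%R|exact: S_le].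
  by rewrite ler_pdivlMr//; lra.
- by move: rF; rewrite -ss Fs lte_fin subrr; lra.
Qed.

(** Rational slopes suffice: increasing a slightly does not decrease F°(a) and
    changes the value of s |-> F°(a) - a s at [s0] by little. *)
Lemma Fcirc_biconjugate s0 r : (0 <= s0)%R -> r%:E < F s0 ->
  exists q : rat, Fcirc F (ratr q) \is a fin_num /\
    (r < Fcirc_real (ratr q) - ratr q * s0)%R.
Proof.
move=> s00 rF.
have [r' rr' r'F] : exists2 r', (r < r')%R & r'%:E < F s0.
  case: (F s0) rF => [x||]// rF; last by exists (r + 1)%R; rewrite ?ltry//; lra.
  by exists ((r + x) / 2)%R; move: rF; rewrite !lte_fin; lra.
have [k kF] := affine_minorant s00 r'F.
have e0 : (0 < (r' - r) / (s0 + 1))%R by rewrite divr_gt0//; lra.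
have [|q] := @rat_in_itvoo _ (- k)%R (- k + (r' - r) / (s0 + 1))%R; first lra.
rewrite in_itv/= => /andP[kq qk].
have h s : (0 <= s)%R -> ((r' - k * s0) - ratr q * s)%:E <= F s.
  move=> s0'; apply: le_trans (kF _ s0'); rewrite lee_fin.
  have : (- k * s <= ratr q * s)%R by rewrite ler_wpM2r// ltW.
  lra.
exists q; split; first by apply/Fcirc_finP; exists (r' - k * s0)%R.
have := Fcirc_real_ge h.
suff : ((ratr q + k) * s0 < r' - r)%R by lra.
have sp : (0 < s0 + 1)%R by lra.
have : ((ratr q + k) * (s0 + 1) < r' - r)%R by rewrite -ltr_pdivlMr//; lra.
have qk0 : (0 < ratr q + k)%R by lra.
lra.
Qed.

End GammaF.
End ConcaveConjugate.

(** * Recession constants *)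

Section Recession.
Context {R : realType}.
Variable F : R -> \bar R.
Hypothesis GF : Gamma F.

Definition recession_sup : \bar R :=
  ereal_sup [set (- a)%:E | a in [set a : R | Fcirc F a \is a fin_num]].

Lemma recession_sup_ge a : Fcirc F a \is a fin_num -> (- a)%:E <= recession_sup.
Proof. by move=> fa; apply: ereal_sup_ubound; exists a. Qed.

Lemma recession_sup_ge0 : 0 <= recession_sup.
Proof. by have := recession_sup_ge (Fcirc0_fin GF (lexx 0%R)).1; rewrite oppr0. Qed.

Lemma recession_lower r : r%:E < recession_sup ->
  \forall s \near +oo%R, r%:E <= (s^-1)%:E * F s.
Proof.
move=> /ereal_sup_gt[_ [a fa <-]]; rewrite lte_fin => ra.
have h := Fcirc_real_le fa; set b := Fcirc_real F a in h.
near=> s.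
have s0 : (0 < s)%R by near: s; apply: nbhs_pinfty_gt; exact: num_real.
have bs : (- b / (- a - r) <= s)%R by near: s; apply: nbhs_pinfty_ge; exact: num_real.
rewrite lee_pdivlMl// -EFinM; apply: le_trans (h _ (ltW s0)).
move: bs; rewrite ler_pdivrMr ?subr_gt0// lee_fin; lra.
Unshelve. all: by end_near. Qed.

(** If F exceeded its chord of slope r' somewhere to the right of [s0], convexity
    would keep it above this chord from there on, so r' would be the slope of an
    affine minorant, against r' > sup. *)
Lemma recession_upper r : recession_sup < r%:E ->
  \forall s \near +oo%R, (s^-1)%:E * F s <= r%:E.
Proof.
move=> Lr; have [r' Lr' r'r] : exists2 r' : R, recession_sup < r'%:E & (r' < r)%R.
  have := recession_sup_ge0; case: recession_sup Lr => [x||]//.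
  by rewrite lte_fin => xr _; exists ((x + r) / 2)%R; rewrite ?lte_fin; lra.
have r'0 : (0 < r')%R by rewrite -lte_fin; exact: le_lt_trans recession_sup_ge0 Lr'.
have [s0 [v [s00 v0 Fs0]]] := Gamma_dom GF.
have growth t : (s0 < t)%R -> F t <= (v + r' * (t - s0))%:E.
  move=> st; rewrite leNgt; apply/negP => Ft.
  suff /recession_sup_ge : Fcirc F (- r')%R \is a fin_num.
    by rewrite opprK leNgt Lr'.
  apply/(Fcirc_finP GF); exists (- r' * t - r' * s0)%R => s s0'.
  have [ts|ts] := ltP t s; last first.
    apply: le_trans (Gamma_ge0 GF s0'); rewrite lee_fin.
    by have := ler_wpM2l (ltW r'0) ts; have := mulr_gt0 r'0 s00; lra.
  pose l := ((s - t) / (s - s0))%R.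
  have ss : (0 < s - s0)%R by lra.
  have l01 : (0 <= l <= 1)%R by rewrite divr_ge0 ?ler_pdivrMr/=; lra.
  have := Gamma_convex GF (ltW s00) s0' l01.
  have ssN : (s - s0 != 0)%R by rewrite gt_eqF.
  have -> : (l * s0 + (1 - l) * s = t)%R by rewrite /l; field.
  rewrite Fs0 => /(lt_le_trans Ft).
  case Fs : (F s) => [w||]; rewrite ?leey//; last first.
    by have := Gamma_ge0 GF s0'; rewrite Fs.
  rewrite -!EFinM -EFinD lte_fin lee_fin => /ltW/(ler_wpM2r (ltW ss)).
  have -> : ((l * v + (1 - l) * w) * (s - s0) = (s - t) * v + (t - s0) * w)%R.
    by rewrite /l; field.
  move=> h; have ts0 : (0 < t - s0)%R by lra.
  have : (v + r' * (s - s0) <= w)%R by rewrite -(ler_pM2l ts0); lra.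
  by have := mulr_gt0 r'0 (lt_trans s00 st); lra.
near=> s.
have s0' : (0 < s)%R by near: s; apply: nbhs_pinfty_gt; exact: num_real.
have ss : (s0 < s)%R by near: s; apply: nbhs_pinfty_gt; exact: num_real.
have vs : (v / (r - r') <= s)%R by near: s; apply: nbhs_pinfty_ge; exact: num_real.
rewrite lee_pdivrMl// -EFinM; apply: le_trans (growth _ ss) _.
move: vs; rewrite ler_pdivrMr ?subr_gt0// lee_fin.
by have := mulr_gt0 r'0 s00; lra.
Unshelve. all: by end_near. Qed.

(** The limit defining the recession constant exists; its value is the
    supremum of the slopes - a of the affine minorants. This form is the one that both
    inequalities for the singular part of the entropy use. *)
Lemma recessionE : recession F = recession_sup.
Proof.
apply: cvg_lim => //; have := recession_sup_ge0.
have := recession_lower; have := recession_upper.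
case: recession_sup => [l| |] // up lo _.
- apply/fine_cvgP; split.
    have := lo (l - 1)%R; have := up (l + 1)%R; rewrite !lte_fin.
    move=> /(_ ltac:(lra)) h1 /(_ ltac:(lra)) h2.
    near=> s; rewrite fin_numE; apply/andP; split.
      rewrite gt_eqF//; apply: lt_le_trans (_ : (l - 1)%:E <= _); first exact: ltNyr.
      by near: s.
    rewrite lt_eqF//; apply: le_lt_trans (_ : (l + 1)%:E < +oo); last exact: ltry.
    by near: s.
  apply/cvgrPdist_le => e e0.
  have := lo (l - e)%R; have := up (l + e)%R; rewrite !lte_fin.
  move=> /(_ ltac:(lra)) h1 /(_ ltac:(lra)) h2.
  near=> s.
  have : (s^-1)%:E * F s <= (l + e)%:E by near: s.
  have : (l - e)%:E <= (s^-1)%:E * F s by near: s.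
  rewrite /=; case: ((s^-1)%:E * F s) => [x| |]//; rewrite !lee_fin => h h'.
  by rewrite ler_distlC; apply/andP; split.
- by apply/cvgeyPge => A; apply: lo; rewrite ltry.
Unshelve. all: by end_near. Qed.

End Recession.

(** * Integrals over finite measurable partitions *)

(** Simple functions are written a (idx x) with an index in nat: the same
    partition carries the values of phi, of F°(phi) and of the masses. *)
Section IndexedPartition.
Context d (T : measurableType d) (R : realType).
Variable m : {finite_measure set T -> \bar R}.
Variables (n : nat) (idx : T -> nat).
Hypothesis midx : measurable_fun setT idx.
Hypothesis idx_lt : forall x, (idx x < n)%N.

Local Notation A j := (idx @^-1` [set (j : nat)]).

Lemma measurable_fiber j : measurable (A j).
Proof. by rewrite -[A j]setTI; exact: midx. Qed.

Lemma measurable_comp_idx d' (U : measurableType d') (b : nat -> U) :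
  measurable_fun setT (fun x => b (idx x)).
Proof. by apply: (measurableT_comp (f := b)). Qed.

Lemma fibers_cover : \big[setU/set0]_(j <- iota 0 n) A j = setT.
Proof.
apply/seteqP; split => // x _.
rewrite -bigcup_seq /=; exists (idx x) => //=.
by rewrite mem_iota/= add0n idx_lt.
Qed.

Lemma fibers_trivIset (D : set nat) : trivIset D (fun j => A j).
Proof. by move=> i j _ _ [x [/= <- <-]]. Qed.

Lemma integral_indexed (a : nat -> R) :
  \int[m]_x (a (idx x))%:E = (\sum_(j < n) a j * fine (m (A j)))%:E.
Proof.
rewrite -{1}fibers_cover integral_bigsetU_EFin//; last first.
- by rewrite fibers_cover; apply/measurable_EFinP; exact: measurable_comp_idx.
- exact: fibers_trivIset.
- exact: iota_uniq.
- by move=> j; exact: measurable_fiber.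
rewrite -sumEFin -(big_mkord xpredT (fun j => (a j * fine (m (A j)))%:E))/=.
rewrite /index_iota subn0; apply: eq_bigr => j _.
have mA := measurable_fiber j.
rewrite (eq_integral (cst (a j)%:E)).
  by rewrite integral_cst// EFinM fineK// fin_num_measure.
by move=> x; rewrite inE => /= ->.
Qed.

Lemma integrable_indexed (a : nat -> R) :
  m.-integrable setT (fun x => (a (idx x))%:E).
Proof.
apply: (@measurable_bounded_integrable _ _ _ m (fun x => a (idx x))) => //.
- by rewrite ltey_eq fin_num_measure.
- exact: measurable_comp_idx.
- exists (\sum_(j < n) `|a j|)%R; split; first exact: num_real.
  move=> M /ltW SM x _; apply: le_trans SM.
  by rewrite (bigD1 (Ordinal (idx_lt x)))//= lerDl sumr_ge0.
Qed.

End IndexedPartition.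

Lemma le_integral_ge0 d (T : measurableType d) (R : realType)
    (m : {measure set T -> \bar R}) (A : set T) (f g : T -> \bar R) :
  measurable A -> m.-integrable A f -> measurable_fun A g ->
  (forall x, A x -> 0 <= g x) -> (forall x, A x -> f x <= g x) ->
  \int[m]_(x in A) f x <= \int[m]_(x in A) g x.
Proof.
move=> mA intf mg g0 fg.
have [gy|gy] := ltP (\int[m]_(x in A) g x) +oo; last by rewrite (le_trans _ gy)// leey.
apply: le_integral => //; last by move=> x; rewrite inE; exact: fg.
apply/integrableP; split => //.
by under eq_integral => x /[!inE] Ax do rewrite gee0_abs ?g0//.
Qed.

(** * Lebesgue decomposition *)

Section LebesgueDecomposition.
Context {R : realType} {X : ptopologicalType}.
Variables gamma mu : {borel_measure X -> R}.

(** The masses that [gamma] gives to [mu]-null sets have an attained supremum,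
    as null sets are stable under countable unions; enlarging a maximiser by
    another null set cannot increase its mass. *)
Lemma null_set_of_maximal_mass : exists N : set (borelType X),
  [/\ measurable N, mu N = 0 & forall A, measurable A -> mu A = 0 ->
    gamma (A `\` N) = 0].
Proof.
pose S := [set gamma A | A in [set A | measurable A /\ mu A = 0]].
have S_le x : S x -> x <= gamma setT.
  by move=> [A [mA _] <-]; apply: le_measure; rewrite ?inE.
have Sfin : ereal_sup S \is a fin_num.
  rewrite ge0_fin_numE.
    apply: le_lt_trans (_ : gamma setT < +oo); first exact/ereal_supP.
    by rewrite ltey_eq fin_num_measure.
  by apply: le_ereal_sup_tmp; exists (gamma set0) => //; exists set0 => //; split.
have /choice[A Ap] k : exists A : set (borelType X), [/\ measurable A, mu A = 0 &
    ereal_sup S - (k.+1%:R^-1)%:E < gamma A].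
  have k0 : (0 < k.+1%:R^-1 :> R)%R by rewrite invr_gt0 ltr0n.
  by have [_ [A [mA A0] <-] h] := ub_ereal_sup_adherent k0 Sfin; exists A.
have mA k : measurable (A k) by have [] := Ap k.
have mN : measurable (\bigcup_k A k) by exact: bigcup_measurable.
have N0 : mu (\bigcup_k A k) = 0.
  apply/eqP; rewrite eq_le measure_ge0 andbT.
  have /le_trans := @measure_sigma_subadditive _ _ _ mu _ A mA mN (@subset_refl _ _).
  apply.
  by rewrite eseries0// => k _ _; have [] := Ap k.
exists (\bigcup_k A k); split => // B mB B0.
have mBN : measurable (B `\` \bigcup_k A k) by exact: measurableD.
have fN : gamma (\bigcup_k A k) \is a fin_num by exact: fin_num_measure.
apply/eqP; rewrite eq_le measure_ge0 andbT -(leeD2rE _ _ fN) add0e.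
rewrite -measureU//; last by rewrite setDKI.
apply: le_trans (_ : ereal_sup S <= _).
  apply: ereal_sup_ubound; exists (B `\` \bigcup_k A k `|` \bigcup_k A k) => //.
  split; first exact: measurableU.
  apply/eqP; rewrite eq_le measure_ge0 andbT -[leRHS]B0.
  apply: le_trans (_ : mu (B `\` \bigcup_k A k) + mu (\bigcup_k A k) <= _).
    exact: measureU2.
  by rewrite N0 adde0; apply: le_measure; rewrite ?inE//; exact: subDsetl.
apply/lee_addgt0Pr => e e0.
pose k := Num.truncn e^-1.
have ke : (k.+1%:R^-1 <= e)%R.
  by rewrite invf_ple ?posrE ?ltr0n// ltW// truncnS_gt.
have [_ _ /ltW] := Ap k; rewrite leeBlDr// => /le_trans; apply.
apply: leeD; last by rewrite lee_fin.
by apply: le_measure; rewrite ?inE//; exact: bigcup_sup.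
Qed.

(** Off the maximising null set, [gamma] is absolutely continuous and the
    Radon-Nikodym theorem gives the density. *)
Lemma lebesgue_decomposition_exists : exists sigma gamma_perp,
  lebesgue_decomposition gamma mu sigma gamma_perp.
Proof.
have [N [mN N0 Nmax]] := null_set_of_maximal_mass.
have mNC : measurable (~` N) by exact: measurableC.
pose gac : {finite_measure set (borelType X) -> \bar R} := mrestr gamma mNC.
have dom : gac `<< mu.
  apply/null_content_dominatesP => A mA A0.
  by rewrite /gac/= /mrestr -setDE Nmax.
have [f [f0 ffin fint fE]] := radon_nikodym_sigma_finite dom.
pose gp : {finite_measure set (borelType X) -> \bar R} := mrestr gamma mN.
exists (fine \o f), gp; split.
- by apply: measurableT_comp => //; exact: measurable_int fint.
- by move=> x /=; rewrite fine_ge0.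
- move=> A mA; rewrite (eq_integral f); last by move=> x _ /=; rewrite fineK.
  rewrite -fE// /gac/= /mrestr -measureU -?setIUr ?setvU ?setIT//.
  + exact: measurableI.
  + exact: measurableI.
  + by rewrite setIACA setICl setI0.
- by exists N; split => //; rewrite /= /mrestr setICl measure0.
Qed.

End LebesgueDecomposition.

(** * Dual description of the relative entropy *)

(** [F] is the increasing limit of the maxima of its first affine minorants of
    rational slope. The index of the active minorant is kept, since it defines
    the simple function phi at which the dual integrand is evaluated. *)
Section AffineMinorants.
Context {R : realType}.
Variable F : R -> \bar R.
Hypothesis GF : Gamma F.

(** The parameter a = 0 comes first: its minorant inf F is nonnegative, hence so are all the
    maxima and monotone convergence applies. *)
Definition slope_seq (k : nat) : R :=
  if k is k'.+1 then
    let q := ratr (odflt 0%R (unpickle k' : option rat)) in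
    if Fcirc F q \is a fin_num then q else 0%R
  else 0%R.

Lemma slope_seq_fin k : Fcirc F (slope_seq k) \is a fin_num.
Proof.
have F0 := (Fcirc0_fin GF (lexx 0%R)).1.
by case: k => [|k] //=; case: ifPn.
Qed.

Definition minorant k (s : R) : R :=
  (Fcirc_real F (slope_seq k) - slope_seq k * s)%R.

Fixpoint best_index (N : nat) (s : R) : nat :=
  if N is N'.+1 then
    if (minorant (best_index N' s) s < minorant N s)%R then N
    else best_index N' s
  else 0%N.

Definition max_minorant N s := minorant (best_index N s) s.

Lemma best_index_le N s : (best_index N s <= N)%N.
Proof. by elim: N => //= N ih; case: ifP => // _; exact: leqW. Qed.

Lemma max_minorantS N s :
  max_minorant N.+1 s = Num.max (max_minorant N s) (minorant N.+1 s).
Proof. by rewrite /max_minorant /=; case: ltP. Qed.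

Lemma max_minorant_le s :
  {homo max_minorant ^~ s : n m / (n <= m)%N >-> (n <= m)%R}.
Proof.
apply: homo_leq => // [? ? ?|N]; first exact: le_trans.
by rewrite max_minorantS le_max lexx.
Qed.

Lemma minorant_le_max k s : (minorant k s <= max_minorant k s)%R.
Proof. by case: k => [|k] //; rewrite max_minorantS le_max lexx orbT. Qed.

Lemma max_minorant_ge0 N s : (0 <= max_minorant N s)%R.
Proof.
apply: le_trans (max_minorant_le _ (leq0n N)).
rewrite /max_minorant/= /minorant/= mul0r subr0.
exact: (Fcirc0_fin GF (lexx 0%R)).2.
Qed.

Lemma max_minorant_le_F N s : (0 <= s)%R -> (max_minorant N s)%:E <= F s.
Proof. by move=> s0; apply: Fcirc_real_le => //; exact: slope_seq_fin. Qed.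

Lemma cvg_max_minorant s : (0 <= s)%R ->
  (max_minorant N s)%:E @[N --> \oo] --> F s.
Proof.
move=> s0; set u := fun N => (max_minorant N s)%:E.
suff <- : ereal_sup (range u) = F s.
  apply: ereal_nondecreasing_cvgn => n m nm.
  by rewrite lee_fin; exact: max_minorant_le.
apply/eqP; rewrite eq_le; apply/andP; split.
  by apply: ge_ereal_sup => _ [N _ <-]; exact: max_minorant_le_F.
rewrite leNgt; apply/negP => lt.
have sup0 : 0 <= ereal_sup (range u).
  apply: le_ereal_sup_tmp; exists (u 0%N); first by exists 0%N.
  by rewrite lee_fin max_minorant_ge0.
have supfin : ereal_sup (range u) \is a fin_num.
  by rewrite ge0_fin_numE// (lt_le_trans lt)// leey.
rewrite -(fineK supfin) in lt.
have [q [qfin qF]] := Fcirc_biconjugate GF s0 lt.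
pose k := (pickle q).+1.
have uk : u k <= ereal_sup (range u) by apply: ereal_sup_ubound; exists k.
move: uk; rewrite -(fineK supfin) lee_fin leNgt => /negP; apply.
apply: lt_le_trans (minorant_le_max _ _).
by rewrite /minorant /slope_seq/= pickleK/= qfin.
Qed.

Lemma measurable_minorant d (T : measurableType d) (sigma : T -> R) k :
  measurable_fun setT sigma -> measurable_fun setT (fun x => minorant k (sigma x)).
Proof.
move=> ms; apply: measurable_funB; first exact: measurable_cst.
by apply: measurable_funM => //; exact: measurable_cst.
Qed.

Lemma measurable_max_minorant d (T : measurableType d) (sigma : T -> R) N :
  measurable_fun setT sigma -> measurable_fun setT (fun x => max_minorant N (sigma x)).
Proof.
move=> ms; elim: N => [|N ih]; first exact: (measurable_minorant 0 ms).
under eq_fun do rewrite max_minorantS.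
by apply: measurable_maxr => //; exact: measurable_minorant.
Qed.

Lemma measurable_best_index d (T : measurableType d) (sigma : T -> R) N :
  measurable_fun setT sigma -> measurable_fun setT (fun x => best_index N (sigma x)).
Proof.
move=> ms; elim: N => [|N ih]; first exact: measurable_cst.
apply: measurable_fun_ifT => //.
apply: measurable_fun_ltr; first exact: measurable_max_minorant.
exact: measurable_minorant.
Qed.

End AffineMinorants.

Section EntropyDuality.
Context {R : realType} {X : ptopologicalType}.
Variable F : R -> \bar R.
Hypothesis GF : Gamma F.
Variables gamma mu gamma_perp : {borel_measure X -> R}.
Variable sigma : borelType X -> R.
Hypothesis dec : lebesgue_decomposition gamma mu sigma gamma_perp.

Let msigma := density_measurable dec.
Let sigma0 := density_ge0 dec.

Lemma measurable_F_density : measurable_fun setT (fun x => F (sigma x)).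
Proof.
apply: (emeasurable_fun_cvg (fun N x => (max_minorant F N (sigma x))%:E)).
- by move=> N; apply/measurable_EFinP; exact: measurable_max_minorant.
- by move=> x _; exact: cvg_max_minorant.
Qed.

Lemma F_density_ge0 x : 0 <= F (sigma x).
Proof. exact: (Gamma_ge0 GF (sigma0 x)). Qed.

Lemma density_integrable A : measurable A ->
  mu.-integrable A (fun x => (sigma x)%:E).
Proof.
move=> mA; apply: (@integrableS _ _ _ _ setT) => //; apply/integrableP; split.
  exact/measurable_EFinP.
under eq_integral => x _ do rewrite gee0_abs ?lee_fin//.
have : gamma setT < +oo by rewrite ltey_eq fin_num_measure.
rewrite (decomposition dec)//; apply: le_lt_trans.
by rewrite leeDl.
Qed.

Definition mass (m : {borel_measure X -> R}) (A : set (borelType X)) : R :=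
  fine (m A).

Lemma massE (m : {borel_measure X -> R}) (A : set (borelType X)) :
  measurable A -> m A = (mass m A)%:E.
Proof. by move=> mA; rewrite fineK// fin_num_measure. Qed.

Lemma integral_density A : measurable A ->
  \int[mu]_(x in A) (sigma x)%:E = (mass gamma A - mass gamma_perp A)%:E.
Proof.
move=> mA; have := decomposition dec mA.
rewrite (massE gamma mA) (massE gamma_perp mA).
have := integrable_fin_num mA (density_integrable mA).
by case: (integral _ _ _) => [x _|//|//]; rewrite -EFinD => -[->]; rewrite addrK.
Qed.

Lemma integral_affine A (b a : R) : measurable A ->
  \int[mu]_(x in A) (b - a * sigma x)%:E =
  (b * mass mu A - a * (mass gamma A - mass gamma_perp A))%:E.
Proof.
move=> mA; under eq_integral do rewrite EFinB.
rewrite integralB_EFin//; last first.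
- under [X in _.-integrable _ X]eq_fun do rewrite /= EFinM.
  exact: integrableZl (density_integrable mA).
- exact: finite_measure_integrable_cst.
under [X in _ - X]eq_integral do rewrite EFinM.
rewrite integralZl//; last exact: density_integrable.
rewrite integral_density// (integral_cst _ mA).
by rewrite [RHS]EFinB (EFinM b) (EFinM a) -(massE mu mA).
Qed.

Section Indexed.
Variables (n : nat) (idx : borelType X -> nat) (a b : nat -> R).
Hypothesis midx : measurable_fun setT idx.
Hypothesis idx_lt : forall x, (idx x < n)%N.
Local Notation A j := (idx @^-1` [set (j : nat)]).

Lemma measurable_affine_indexed :
  measurable_fun setT (fun x => b (idx x) - a (idx x) * sigma x)%R.
Proof.
apply: measurable_funB; first exact: measurable_comp_idx.
by apply: measurable_funM => //; exact: measurable_comp_idx.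
Qed.

Lemma integral_affine_indexed :
  \int[mu]_x (b (idx x) - a (idx x) * sigma x)%:E =
  (\sum_(j < n) (b j * mass mu (A j) -
     a j * (mass gamma (A j) - mass gamma_perp (A j))))%:E.
Proof.
rewrite -{1}(fibers_cover idx_lt) integral_bigsetU_EFin//; last first.
- rewrite fibers_cover//; apply/measurable_EFinP.
  exact: measurable_affine_indexed.
- exact: fibers_trivIset.
- exact: iota_uniq.
- by move=> j; exact: measurable_fiber.
rewrite -sumEFin -(big_mkord xpredT (fun j => (b j * mass mu (A j) -
     a j * (mass gamma (A j) - mass gamma_perp (A j)))%:E))/=.
rewrite /index_iota subn0; apply: eq_bigr => j _.
rewrite -integral_affine; last exact: measurable_fiber.
by apply: eq_integral => x; rewrite inE => /= ->.
Qed.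

Lemma integrable_affine_indexed :
  mu.-integrable setT (fun x => (b (idx x) - a (idx x) * sigma x)%:E).
Proof.
have -> : (fun x => (b (idx x) - a (idx x) * sigma x)%:E) =
   (fun x => \sum_(j < n) ((b j - a j * sigma x)%R * \1_(A j) x)%:E).
  apply/funext => x; rewrite sumEFin (bigD1 (Ordinal (idx_lt x)))//= big1 => [|j ji].
    by rewrite addr0 indicE mem_set// mulr1.
  rewrite indicE memNset ?mulr0//= => e; move/negP: ji; apply.
  by apply/eqP/val_inj.
apply: integrable_sum => // j _.
have mA : measurable (A j) by exact: measurable_fiber.
have -> : (fun x => ((b j - a j * sigma x)%R * \1_(A j) x)%:E) =
    ((fun x => (b j - a j * sigma x)%:E) \_ (A j)).
  apply/funext => x; rewrite patchE indicE; case: ifP => _; rewrite ?mulr1 ?mulr0//.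
apply/(integrable_mkcond _ mA).
under [X in _.-integrable _ X]eq_fun do rewrite /= EFinB EFinM.
apply: integrableB => //; first exact: finite_measure_integrable_cst.
exact: integrableZl (density_integrable mA).
Qed.

End Indexed.

Definition entropy_value := \int[mu]_x F (sigma x) + recession F * gamma_perp setT.

Lemma entropy_value_ge0 : 0 <= entropy_value.
Proof.
rewrite adde_ge0//; first by apply: integral_ge0 => x _; exact: F_density_ge0.
by rewrite mule_ge0// recessionE// recession_sup_ge0.
Qed.

(** Fenchel's inequality on the absolutely continuous part, and - a <= recession F
    on the singular part. *)
Lemma entropy_value_ge n (idx : borelType X -> nat) (a : nat -> R) :
  measurable_fun setT idx -> (forall x, (idx x < n)%N) ->
  (forall j, Fcirc F (a j) \is a fin_num) ->
  (\sum_(j < n) (Fcirc_real F (a j) * mass mu (idx @^-1` [set (j : nat)]) -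
    a j * mass gamma (idx @^-1` [set (j : nat)])))%:E <= entropy_value.
Proof.
move=> midx idx_lt afin.
apply: le_trans (_ : \int[mu]_x (Fcirc_real F (a (idx x)) - a (idx x) * sigma x)%:E +
   \int[gamma_perp]_x (- a (idx x))%:E <= _).
  rewrite (integral_affine_indexed a (fun j => Fcirc_real F (a j)) midx idx_lt).
  rewrite (integral_indexed gamma_perp midx idx_lt (fun j => - a j)%R).
  rewrite -EFinD lee_fin -big_split/= le_eqVlt; apply/orP; left; apply/eqP.
  by apply: eq_bigr => j _; rewrite /mass; ring.
apply: leeD.
- apply: le_integral_ge0 => //.
  + exact: (integrable_affine_indexed a (fun j => Fcirc_real F (a j)) midx idx_lt).
  + exact: measurable_F_density.
  + by move=> x _; exact: F_density_ge0.
  + by move=> x _; exact: Fcirc_real_le.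
- rewrite -(integral_cst gamma_perp measurableT).
  apply: le_integral_ge0 => //.
  + exact: (integrable_indexed gamma_perp midx idx_lt (fun j => - a j)%R).
  + by move=> x _; rewrite /= recessionE// recession_sup_ge0.
  + by move=> x _; rewrite /= recessionE//; exact: recession_sup_ge.
Qed.

(** The test functions take, on a null set carrying the singular part, a value
    [a0] with - a0 close to the recession constant, and elsewhere the
    parameter a of the minorant s |-> F°(a) - a s active at the density. *)
Lemma entropy_value_le (C : R) :
  (forall n (idx : borelType X -> nat) (a : nat -> R),
    measurable_fun setT idx -> (forall x, (idx x < n)%N) ->
    (forall j, Fcirc F (a j) \is a fin_num) ->
    (\sum_(j < n) (Fcirc_real F (a j) * mass mu (idx @^-1` [set (j : nat)]) -
      a j * mass gamma (idx @^-1` [set (j : nat)])) <= C)%R) ->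
  entropy_value <= C%:E.
Proof.
move=> H; have [N [mN N0 pN]] := decomposition_singular dec.
have mNC : measurable (~` N) by exact: measurableC.
have key M a0 : Fcirc F a0 \is a fin_num ->
    \int[mu]_x (max_minorant F M (sigma x))%:E + (- a0)%:E * gamma_perp setT <= C%:E.
  move=> a0fin.
  pose idx x := if x \in N then 0%N else (best_index F M (sigma x)).+1.
  pose a j := if j is k.+1 then slope_seq F k else a0.
  have midx : measurable_fun setT idx.
    apply: measurable_fun_ifT; last 2 first.
    - exact: measurable_cst.
    - by apply: (measurableT_comp (f := S)) => //; exact: measurable_best_index.
    apply: (measurable_fun_bool true); rewrite setTI.
    rewrite (_ : _ @^-1` _ = N)//.
    by apply/seteqP; split=> x; [exact: set_mem|exact: mem_set].
  have idx_lt x : (idx x < M.+2)%N.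
    by rewrite /idx; case: ifP => // _; rewrite !ltnS best_index_le.
  have afin j : Fcirc F (a j) \is a fin_num.
    by case: j => //= k; exact: slope_seq_fin.
  have -> : \int[mu]_x (max_minorant F M (sigma x))%:E =
     \int[mu]_x (Fcirc_real F (a (idx x)) - a (idx x) * sigma x)%:E.
    apply: ae_eq_integral => //.
    - by apply/measurable_EFinP; exact: measurable_max_minorant.
    - apply/measurable_EFinP.
      exact: (measurable_affine_indexed a (fun j => Fcirc_real F (a j))).
    - exists N; split => // x /=; apply: contra_notP => xN _.
      by rewrite /idx memNset.
  rewrite (integral_affine_indexed a (fun j => Fcirc_real F (a j)) midx idx_lt).
  apply: le_trans (_ : (\sum_(j < M.+2) (Fcirc_real F (a j) *
     mass mu (idx @^-1` [set (j : nat)]) -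
      a j * mass gamma (idx @^-1` [set (j : nat)])))%:E <= _); last first.
    by rewrite lee_fin; exact: H.
  rewrite (massE gamma_perp measurableT) -EFinM -EFinD lee_fin -lerBrDl -sumrB.
  rewrite big_ord_recl/= big1 => [|j _].
    have -> : mass gamma_perp (idx @^-1` [set 0%N]) = mass gamma_perp setT.
      have -> : idx @^-1` [set 0%N] = N.
        apply/seteqP; split => x /=; rewrite /idx; first by case: ifPn; rewrite ?inE.
        by move=> Nx; rewrite mem_set.
      have : gamma_perp (N `|` ~` N) = gamma_perp N + gamma_perp (~` N).
        by apply: measureU => //; rewrite setICr.
      by rewrite /mass setUv pN adde0 => ->.
    lra.
  have -> : mass gamma_perp (idx @^-1` [set (bump 0 j : nat)]) = 0%R.
    rewrite /mass (@subset_measure0 _ _ _ gamma_perp _ (~` N))//.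
    - exact: measurable_fiber.
    - by move=> x /=; rewrite /idx; case: ifPn => //; rewrite notin_setE.
  lra.
have key2 M : \int[mu]_x (max_minorant F M (sigma x))%:E +
    recession F * gamma_perp setT <= C%:E.
  have fin := (Fcirc0_fin GF (lexx 0%R)).1.
  have := key M 0%R fin; rewrite oppr0 mul0e adde0 => key0.
  rewrite (massE gamma_perp measurableT).
  (* Without singular part the product is 0 even if [recession F] is +oo. *)
  have [p0|p0] := eqVneq (mass gamma_perp setT) 0%R.
    by rewrite p0 mule0 adde0.
  have p_gt0 : (0 < mass gamma_perp setT)%R by rewrite lt_neqAle eq_sym p0 fine_ge0.
  have Ifin : \int[mu]_x (max_minorant F M (sigma x))%:E \is a fin_num.
    rewrite ge0_fin_numE ?(le_lt_trans key0) ?ltry//.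
    by apply: integral_ge0 => x _; rewrite lee_fin max_minorant_ge0.
  rewrite addeC -leeBrDr// muleC -lee_pdivlMl// recessionE//.
  apply: ge_ereal_sup => _ [a0 a0fin <-].
  rewrite lee_pdivlMl// leeBrDr// addeC muleC.
  by rewrite -(massE gamma_perp measurableT); exact: key.
rewrite /entropy_value.
have rp0 : 0 <= recession F * gamma_perp setT.
  by rewrite mule_ge0// recessionE// recession_sup_ge0.
have rpfin : recession F * gamma_perp setT \is a fin_num.
  rewrite ge0_fin_numE//; apply: le_lt_trans (ltry C); apply: le_trans (key2 0%N).
  by rewrite leeDr//; apply: integral_ge0 => x _; rewrite lee_fin max_minorant_ge0.
rewrite -leeBrDr//.
have cvgI := @cvg_monotone_convergence _ _ _ mu setT measurableT
  (fun M x => (max_minorant F M (sigma x))%:E).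
have {}cvgI : \int[mu]_x (max_minorant F M (sigma x))%:E @[M --> \oo] -->
    \int[mu]_x F (sigma x).
  have -> : \int[mu]_x F (sigma x) =
      \int[mu]_x limn (fun M => (max_minorant F M (sigma x))%:E).
    by apply: eq_integral => x _; apply/esym/cvg_lim => //; exact: cvg_max_minorant.
  apply: cvgI.
  - by move=> M; apply/measurable_EFinP; exact: measurable_max_minorant.
  - by move=> M x _; rewrite lee_fin max_minorant_ge0.
  - by move=> x _ M M' MM; rewrite lee_fin; exact: max_minorant_le.
rewrite -(cvg_lim _ cvgI)//; apply: lime_le.
  by apply/cvg_ex; eexists; exact: cvgI.
by apply: nearW => M; rewrite leeBrDr//; exact: key2.
Qed.

End EntropyDuality.

(** * Borel functions, marginals and partition values *)

Section BorelFunctions.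
Context {R : realType}.

Lemma open_borel (X : ptopologicalType) (U : set X) :
  open U -> measurable (U : set (borelType X)).
Proof. by move=> oU; exact: sub_sigma_algebra. Qed.

Lemma closed_borel (X : ptopologicalType) (A : set X) :
  closed A -> measurable (A : set (borelType X)).
Proof.
move=> cA; rewrite -[A]setCK; apply: measurableC; apply: open_borel.
exact: closed_openC.
Qed.

Lemma compact_borel (X : ptopologicalType) (K : set X) :
  hausdorff_space X -> compact K -> measurable (K : set (borelType X)).
Proof. by move=> hX /(compact_closed hX); exact: closed_borel. Qed.

Lemma lsc_borel_measurable (X : ptopologicalType) (f : X -> \bar R) :
  lower_semicontinuous f -> measurable_fun setT (f : borelType X -> \bar R).
Proof.
move=> scif; apply: (measurability _ (ErealGenOInfty.measurableE R)).
move=> /= _ [_ [a ->]] <-; apply: measurableI => //; apply: open_borel.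
by rewrite preimage_itvoy; move/lower_semicontinuousP : scif; exact.
Qed.

Lemma continuous_borel_measurable (X Y : ptopologicalType) (f : X -> Y) :
  continuous f -> measurable_fun setT (f : borelType X -> borelType Y).
Proof.
move=> cf; apply: (@measurability _ _ _ (borelType Y) _ _ (@open Y)) => //.
by move=> _ [U oU <-]; rewrite setTI; apply: open_borel; move/continuousP : cf; exact.
Qed.

Lemma fst_borel (X1 X2 : ptopologicalType) :
  measurable_fun setT (fst : borelType (X1 * X2)%type -> borelType X1).
Proof. by apply: continuous_borel_measurable => x; exact: cvg_fst. Qed.

Lemma snd_borel (X1 X2 : ptopologicalType) :
  measurable_fun setT (snd : borelType (X1 * X2)%type -> borelType X2).
Proof. by apply: continuous_borel_measurable => x; exact: cvg_snd. Qed.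

Lemma finite_range_preimage d (T : measurableType d) (phi : T -> R) (Y : set R) :
  measurable_fun setT phi -> finite_set (range phi) -> measurable (phi @^-1` Y).
Proof.
move=> mphi frange.
have -> : phi @^-1` Y = \bigcup_(v in range phi `&` Y) phi @^-1` [set v].
  apply/seteqP; split => [x Yx|x [v [_ Yv] /= e]]; last by rewrite /= e.
  by exists (phi x) => //; split => //; exists x.
apply: fin_bigcup_measurable; first exact: finite_setIl.
by move=> v _; rewrite -[X in measurable X]setTI; exact: mphi.
Qed.

Lemma finite_range_indexed d (T : measurableType d) (phi : T -> R) :
  measurable_fun setT phi -> finite_set (range phi) ->
  exists n (idx : T -> nat) (a : nat -> R), [/\ measurable_fun setT idx,
    forall x, (idx x < n)%N, forall x, phi x = a (idx x) &
    forall j, range phi (a j)].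
Proof.
move=> mphi frange; have /finite_seqP[s sE] := frange.
have phis x : phi x \in s.
  have h : range phi (phi x) by exists x.
  by rewrite sE in h.
exists (size s), (fun x => index (phi x) s), (nth (phi point) s); split.
- move=> _ Y _; rewrite setTI.
  exact: (finite_range_preimage [set v | Y (index v s)]).
- by move=> x; rewrite index_mem.
- by move=> x; rewrite nth_index.
- move=> j; have [js|js] := ltnP j (size s); last first.
    by rewrite nth_default//; exists point.
  by have := mem_nth (phi point) js; rewrite sE.
Qed.

End BorelFunctions.

Section RelativeEntropyValue.
Context {R : realType} {X : ptopologicalType}.
Variable F : R -> \bar R.
Hypothesis GF : Gamma F.
Variables gamma mu : {borel_measure X -> R}.

(** The relative entropy is a choice among the values of all decompositions; one
    exists, so the chosen value comes from some decomposition, and the bounds of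
    the previous section hold for each of them. *)
Lemma relative_entropyE : exists (sigma : borelType X -> R)
    (gamma_perp : {borel_measure X -> R}),
  lebesgue_decomposition gamma mu sigma gamma_perp /\
  relative_entropy F gamma mu = entropy_value F mu gamma_perp sigma.
Proof.
have [sigma [gp dec]] := lebesgue_decomposition_exists gamma mu.
have [|s [g [h e]]] := @getPex _ [set v | exists sigma gamma_perp,
    lebesgue_decomposition gamma mu sigma gamma_perp /\
    v = \int[mu]_x F (sigma x) + recession F * gamma_perp setT].
  by eexists; exists sigma, gp.
by exists s, g.
Qed.

Lemma relative_entropy_ge0 : 0 <= relative_entropy F gamma mu.
Proof. by have [s [g [h ->]]] := relative_entropyE; exact: entropy_value_ge0 h. Qed.

Definition partition_value n (idx : borelType X -> nat) (a : nat -> R) : R :=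
  (\sum_(j < n) (Fcirc_real F (a j) * mass mu (idx @^-1` [set (j : nat)]) -
    a j * mass gamma (idx @^-1` [set (j : nat)])))%R.

Lemma relative_entropy_ge n (idx : borelType X -> nat) (a : nat -> R) :
  measurable_fun setT idx -> (forall x, (idx x < n)%N) ->
  (forall j, Fcirc F (a j) \is a fin_num) ->
  (partition_value n idx a)%:E <= relative_entropy F gamma mu.
Proof.
have [s [g [h ->]]] := relative_entropyE => *.
exact: (entropy_value_ge GF h).
Qed.

Lemma relative_entropy_le (C : R) :
  (forall n (idx : borelType X -> nat) (a : nat -> R),
    measurable_fun setT idx -> (forall x, (idx x < n)%N) ->
    (forall j, Fcirc F (a j) \is a fin_num) ->
    (partition_value n idx a <= C)%R) ->
  relative_entropy F gamma mu <= C%:E.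
Proof.
by have [s [g [h ->]]] := relative_entropyE => H; apply: (entropy_value_le GF h).
Qed.

End RelativeEntropyValue.

Section Marginals.
Context {R : realType} {X1 X2 : ptopologicalType}.
Variable gamma : {borel_measure (X1 * X2)%type -> R}.

Lemma pushforward_finite_measure d d' (T : measurableType d) (U : measurableType d')
    (m : {finite_measure set T -> \bar R}) (f : T -> U) :
  measurable_fun setT f -> exists nu : {finite_measure set U -> \bar R},
    (nu : set U -> \bar R) = pushforward m f.
Proof.
move=> mf.
have fin : fin_num_fun (pushforward m f).
  move=> A mA; apply: fin_num_measure; rewrite -[X in measurable X]setTI; exact: mf.
pose mu0 : {measure set U -> \bar R} :=
  @measure_function_pushforward__canonical__measure_function_Measure
    _ _ _ _ _ m f mf.
pose mu1 : {finite_measure set U -> \bar R} :=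
  HB.pack (Measure.sort mu0) (Measure.class mu0)
    (Measure_isFinite.Build _ U R mu0 fin).
by exists mu1.
Qed.

Lemma marginal1_measure : exists g1 : {borel_measure X1 -> R},
  (g1 : set (borelType X1) -> \bar R) = marginal1 gamma.
Proof. exact: pushforward_finite_measure (@fst_borel X1 X2). Qed.

Lemma marginal2_measure : exists g2 : {borel_measure X2 -> R},
  (g2 : set (borelType X2) -> \bar R) = marginal2 gamma.
Proof. exact: pushforward_finite_measure (@snd_borel X1 X2). Qed.

End Marginals.

(** * Weak duality *)

Section AdmissibleFunctions.
Context {R : realType} {X : ptopologicalType}.
Variable F : R -> \bar R.

Lemma admissible_measurable (phi : X -> R) : simple_lsc_admissible F phi ->
  measurable_fun setT (phi : borelType X -> R).
Proof. by move=> [_ /lsc_borel_measurable/measurable_EFinP]. Qed.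

Lemma admissible_fin (phi : X -> R) x : simple_lsc_admissible F phi ->
  Fcirc F (phi x) \is a fin_num.
Proof.
move=> [_ _ [M h]]; rewrite fin_num_abs; exact: le_lt_trans (h x) (ltry M).
Qed.

Lemma admissible_indexed (phi : X -> R) : simple_lsc_admissible F phi ->
  exists n (idx : borelType X -> nat) (a : nat -> R), [/\ measurable_fun setT idx,
    forall x, (idx x < n)%N, forall x, phi x = a (idx x) &
    forall j, Fcirc F (a j) \is a fin_num].
Proof.
move=> adm; have [frange _ _] := adm.
have [n [idx [a [midx idx_lt e ra]]]] :=
  finite_range_indexed (admissible_measurable adm) frange.
by exists n, idx, a; split => // j; have [x _ <-] := ra j; exact: admissible_fin.
Qed.

Lemma admissible_integrable (m : {borel_measure X -> R}) (phi : X -> R) (b : R -> R) :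
  simple_lsc_admissible F phi -> m.-integrable setT (fun x => (b (phi x))%:E).
Proof.
move=> /admissible_indexed[n [idx [a [midx idx_lt e _]]]].
under [X in _.-integrable _ X]eq_fun do rewrite e.
exact: (integrable_indexed _ midx idx_lt (b \o a)).
Qed.

Lemma Fcirc_admissibleE (phi : X -> R) x : simple_lsc_admissible F phi ->
  Fcirc F (phi x) = (Fcirc_real F (phi x))%:E.
Proof. by move=> adm; apply: Fcirc_realE; exact: admissible_fin. Qed.

Lemma marginal_weak_duality (GF : Gamma F) (mu g : {borel_measure X -> R})
    (phi : X -> R) : simple_lsc_admissible F phi ->
  \int[mu]_x Fcirc F (phi x) <= relative_entropy F g mu + \int[g]_x (phi x)%:E.
Proof.
move=> adm; under eq_integral do rewrite Fcirc_admissibleE//.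
have [n [idx [a [midx idx_lt e afin]]]] := admissible_indexed adm.
under eq_integral do rewrite e.
rewrite (integral_indexed mu midx idx_lt (Fcirc_real F \o a)).
under eq_integral do rewrite e.
rewrite (integral_indexed g midx idx_lt a) -leeBlDr// -EFinB -sumrB.
exact: (relative_entropy_ge GF g mu midx idx_lt afin).
Qed.

End AdmissibleFunctions.

Lemma admissible_pushforward {R : realType} (Y X : ptopologicalType)
    (p : borelType Y -> borelType X) (F : R -> \bar R)
    (m : {borel_measure Y -> R}) (g : {borel_measure X -> R}) (phi : X -> R) :
  measurable_fun setT p ->
  (g : set (borelType X) -> \bar R) = pushforward m p ->
  simple_lsc_admissible F phi ->
  \int[g]_x (phi x)%:E = \int[m]_y (phi (p y))%:E /\
  m.-integrable setT (fun y => (phi (p y))%:E).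
Proof.
move=> mp e /admissible_indexed[n [idx [a [midx idx_lt ph _]]]].
have midx' : measurable_fun setT (idx \o p) by exact: measurableT_comp.
have idx_lt' y : (idx (p y) < n)%N by [].
split.
  under eq_integral do rewrite ph.
  rewrite (integral_indexed g midx idx_lt a) e.
  under eq_integral do rewrite ph.
  by rewrite (integral_indexed m midx' idx_lt' a).
under [X in _.-integrable _ X]eq_fun do rewrite ph.
exact: (integrable_indexed m midx' idx_lt' a).
Qed.

Section WeakDuality.
Context {R : realType} {X1 X2 : ptopologicalType}.
Variables (F1 F2 : R -> \bar R) (c : X1 * X2 -> \bar R).
Variables (mu1 : {borel_measure X1 -> R}) (mu2 : {borel_measure X2 -> R}).
Hypotheses (GF1 : Gamma F1) (GF2 : Gamma F2).
Hypotheses (c_ge0 : forall x, 0 <= c x) (c_lsc : lower_semicontinuous c).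

Lemma weak_duality (gamma : {borel_measure (X1 * X2)%type -> R})
    (phi : (X1 -> R) * (X2 -> R)) : Phi F1 F2 c phi ->
  dual_functional F1 F2 mu1 mu2 phi <= ET_functional F1 F2 c mu1 mu2 gamma.
Proof.
move=> [adm1 adm2 phic].
have [g1 e1] := marginal1_measure gamma; have [g2 e2] := marginal2_measure gamma.
rewrite /ET_functional -e1 -e2 /dual_functional.
apply: le_trans (leeD (marginal_weak_duality GF1 mu1 g1 adm1)
  (marginal_weak_duality GF2 mu2 g2 adm2)) _.
rewrite addeACA leeD2l//.
have [-> i1] := admissible_pushforward (@fst_borel X1 X2) e1 adm1.
have [-> i2] := admissible_pushforward (@snd_borel X1 X2) e2 adm2.
rewrite -integralD//; apply: le_integral_ge0 => //.
- exact: integrableD.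
- exact: lsc_borel_measurable.
- by move=> [x1 x2] _ /=; rewrite -EFinD.
Qed.

Lemma dual_value_le_ET :
  dual_value F1 F2 c mu1 mu2 <= ET F1 F2 c mu1 mu2.
Proof.
apply: le_ereal_inf_tmp => _ [gamma _ <-].
by apply: ge_ereal_sup => _ [phi Pphi <-]; exact: weak_duality.
Qed.

End WeakDuality.

Local Close Scope ereal_scope.

(** * Positive functionals and their Radon regularisation *)

Section PositiveFunctional.
Context {R : realType} {T : Type}.

Definition bounded_fun_set : set (T -> R) :=
  [set f | exists M, forall x, `|f x| <= M].

(** Integration against a finitely additive measure defined on all subsets. *)
Record positive_functional (L : (T -> R) -> R) : Prop := {
  pf_add : forall f g, bounded_fun_set f -> bounded_fun_set g ->
    L (f \+ g) = L f + L g;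
  pf_scale : forall t f, bounded_fun_set f -> L (fun x => t * f x) = t * L f;
  pf_pos : forall f, bounded_fun_set f -> (forall x, 0 <= f x) -> 0 <= L f }.

Lemma bounded_cst b : bounded_fun_set (fun=> b).
Proof. by exists `|b|. Qed.

Lemma bounded_add f g : bounded_fun_set f -> bounded_fun_set g ->
  bounded_fun_set (f \+ g).
Proof.
move=> [M Mf] [N Ng]; exists (M + N) => x.
by apply: le_trans (ler_normD _ _) _; apply: lerD.
Qed.

Lemma bounded_scale t f : bounded_fun_set f -> bounded_fun_set (fun x => t * f x).
Proof.
by move=> [M Mf]; exists (`|t| * M) => x; rewrite normrM ler_wpM2l.
Qed.

Lemma bounded_indic (A : set T) : bounded_fun_set (\1_A).
Proof. by exists 1 => x; rewrite indicE; case: (x \in A); rewrite ?normr1 ?normr0. Qed.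

Lemma bounded_sum n (f : 'I_n -> T -> R) : (forall j, bounded_fun_set (f j)) ->
  bounded_fun_set (fun x => \sum_(j < n) f j x).
Proof.
move=> /choice[M Mf]; exists (\sum_(j < n) M j) => x.
by apply: le_trans (ler_norm_sum _ _ _) _; apply: ler_sum.
Qed.

Section Theory.
Variable L : (T -> R) -> R.
Hypothesis HL : positive_functional L.

Lemma pf_le f g : bounded_fun_set f -> bounded_fun_set g ->
  (forall x, f x <= g x) -> L f <= L g.
Proof.
move=> bf bg fg.
have bNf : bounded_fun_set (fun x => -1 * f x) by exact: bounded_scale.
have : 0 <= L (g \+ (fun x => -1 * f x)).
  apply: (pf_pos HL); first exact: bounded_add.
  by move=> x /=; rewrite mulN1r subr_ge0.
by rewrite (pf_add HL)// (pf_scale HL)// mulN1r subr_ge0.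
Qed.

Lemma pf_sum n (f : 'I_n -> T -> R) : (forall j, bounded_fun_set (f j)) ->
  L (fun x => \sum_(j < n) f j x) = \sum_(j < n) L (f j).
Proof.
elim: n f => [|n ih] f bf.
  rewrite big_ord0 -[RHS](mul0r (L (fun=> 0))) -(pf_scale HL _ (bounded_cst 0)).
  by congr (L _); apply/funext => x; rewrite big_ord0 mul0r.
rewrite big_ord_recl -ih// -(pf_add HL)//; last exact: bounded_sum.
by congr (L _); apply/funext => x; rewrite big_ord_recl.
Qed.

Lemma pf_step n (b0 : R) (b : 'I_n -> R) (U : 'I_n -> set T) :
  L (fun x => b0 + \sum_(j < n) b j * \1_(U j) x) =
  b0 * L (fun=> 1) + \sum_(j < n) b j * L (\1_(U j)).
Proof.
have bU j : bounded_fun_set (fun x => b j * \1_(U j) x).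
  by apply: bounded_scale; exact: bounded_indic.
rewrite -(pf_scale HL)//; last exact: bounded_cst.
under [in RHS]eq_bigr => j _ do rewrite -(pf_scale HL _ (bounded_indic _)).
rewrite -pf_sum// -(pf_add HL); last 2 first.
- by apply: bounded_scale; exact: bounded_cst.
- exact: bounded_sum.
by congr (L _); apply/funext => x /=; rewrite mulr1.
Qed.

Lemma pf_indicU A B : A `&` B = set0 -> L (\1_(A `|` B)) = L \1_A + L \1_B.
Proof.
move=> AB; rewrite -(pf_add HL); [|exact: bounded_indic..].
congr (L _); apply/funext => x /=; rewrite !indicE in_setU.
have [xA|xA] := boolP (x \in A); have [xB|xB] := boolP (x \in B);
  rewrite ?addr0 ?add0r//.
exfalso; have : (A `&` B) x by split; exact: set_mem.
by rewrite AB.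
Qed.

Lemma pf_indic_ge0 A : 0 <= L \1_A.
Proof.
by apply: (pf_pos HL); [exact: bounded_indic|move=> x; rewrite indicE].
Qed.

Lemma pf_indicT : L \1_setT = L (fun=> 1).
Proof. by congr (L _); apply/funext => x; rewrite indicT. Qed.

Lemma pf_sum_disjoint n (U : 'I_n -> set T) :
  (forall i j, i != j -> U i `&` U j = set0) ->
  \sum_(j < n) L (\1_(U j)) <= L (fun=> 1).
Proof.
move=> dU; rewrite -pf_sum; last by move=> j; exact: bounded_indic.
apply: pf_le; [by apply: bounded_sum => j; exact: bounded_indic|exact: bounded_cst|].
move=> x; have [[j Ujx]|nU] := pselect (exists j, U j x).
  rewrite (bigD1 j)//= big1 ?addr0 => [|i ij]; first by rewrite indicE mem_set.
  rewrite indicE memNset// => Uix.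
  by have : (U i `&` U j) x by []; rewrite dU.
rewrite big1// => j _; rewrite indicE memNset// => Ujx; apply: nU; by exists j.
Qed.

End Theory.
End PositiveFunctional.

Lemma pf_comp {R : realType} (S T : Type) (p : S -> T) (L : (S -> R) -> R) :
  positive_functional L -> positive_functional (fun f : T -> R => L (f \o p)).
Proof.
move=> HL.
have bc (f : T -> R) : bounded_fun_set f -> bounded_fun_set (f \o p).
  by move=> [M Mf]; exists M => x; exact: Mf.
split.
- by move=> f g bf bg; rewrite -(pf_add HL)//; exact: bc.
- by move=> t f bf; rewrite -(pf_scale HL)//; exact: bc.
- by move=> f bf f0; apply: (pf_pos HL); [exact: bc|move=> x; exact: f0].
Qed.

Section InnerRegular.
Context {R : realType} {X : ptopologicalType}.
Hypothesis hX : hausdorff_space X.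

(** The form of the Radon property that passes to continuous images, hence from a
    plan to its marginals, and that concerns real masses only. *)
Definition inner_regular (m : {borel_measure X -> R}) :=
  forall (B : set (borelType X)) (e : R), measurable B -> 0 < e ->
  exists K : set X, [/\ compact K, K `<=` B & mass m B <= mass m K + e].

Lemma mass_le (m : {borel_measure X -> R}) (A B : set (borelType X)) :
  measurable A -> measurable B -> A `<=` B -> mass m A <= mass m B.
Proof.
move=> mA mB AB; rewrite -lee_fin -(massE m mA) -(massE m mB).
by apply: le_measure; rewrite ?inE.
Qed.

Lemma mass_ge0 (m : {borel_measure X -> R}) (A : set (borelType X)) : 0 <= mass m A.
Proof. exact: fine_ge0. Qed.

Lemma radon_inner_regular (m : {borel_measure X -> R}) : radon m -> inner_regular m.
Proof.
move=> rm B e mB e0; have fB : m B \is a fin_num by exact: fin_num_measure.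
have h := rm B mB; rewrite h in fB.
have [_ [K [cK KB] <-]] := ub_ereal_sup_adherent e0 fB.
rewrite -h => /ltW lt; exists K; split => //.
have mK := compact_borel hX cK.
by rewrite -lee_fin EFinD -(massE m mB) -(massE m mK) -leeBlDr.
Qed.

(** Two measures at once, because the reference measure and the marginal have to
    be approximated by the same compact sets. *)
Lemma separated_partition (m m' : {borel_measure X -> R}) n
    (idx : borelType X -> nat) (e : R) :
  inner_regular m -> inner_regular m' -> measurable_fun setT idx -> 0 < e ->
  exists K U : 'I_n -> set X, [/\ forall j, compact (K j),
   forall j : 'I_n, K j `<=` U j /\ K j `<=` idx @^-1` [set (j : nat)],
   forall j, open (U j), forall i j, i != j -> U i `&` U j = set0 &
   forall j : 'I_n, mass m (idx @^-1` [set (j : nat)]) <= mass m (K j) + e /\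
             mass m' (idx @^-1` [set (j : nat)]) <= mass m' (K j) + e].
Proof.
move=> rm rm' midx e0; pose A (j : nat) := idx @^-1` [set j].
have mA j : measurable (A j) by exact: measurable_fiber.
have /choice[K Kp] (j : 'I_n) : exists K : set X, [/\ compact K, K `<=` A j,
    mass m (A j) <= mass m K + e & mass m' (A j) <= mass m' K + e].
  have [K [cK KA h]] := rm _ _ (mA j) e0; have [K' [cK' KA' h']] := rm' _ _ (mA j) e0.
  have mK := compact_borel hX cK; have mK' := compact_borel hX cK'.
  have mKK := compact_borel hX (compactU cK cK').
  exists (K `|` K'); split; [exact: compactU|by rewrite subUset| |].
  - by apply: le_trans h _; rewrite lerD2r; apply: mass_le => //; exact: subsetUl.
  - by apply: le_trans h' _; rewrite lerD2r; apply: mass_le => //; exact: subsetUr.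
have [|i j ij|U [oU KU dU]] := disjoint_compact_family_separated hX (K := K).
- by move=> j; have [] := Kp j.
- apply/seteqP; split => // x [Ki Kj].
  have [_ /(_ _ Ki)/= ei _ _] := Kp i; have [_ /(_ _ Kj)/= ej _ _] := Kp j.
  by move/negP: ij; apply; apply/eqP/val_inj; rewrite /= -ei -ej.
- exists K, U; split => // j; have [] := Kp j => //.
Qed.

Lemma mass_fibers (m : {borel_measure X -> R}) n (idx : borelType X -> nat) :
  measurable_fun setT idx -> (forall x, (idx x < n)%N) ->
  \sum_(j < n) mass m (idx @^-1` [set (j : nat)]) = mass m setT.
Proof.
move=> midx idx_lt; have := integral_indexed m midx idx_lt (fun=> 1).
rewrite (integral_cst m measurableT) mul1e => h.
by rewrite /mass h/=; apply: eq_bigr => j _; rewrite mul1r.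
Qed.

Lemma integral_step (m : {borel_measure X -> R}) n (b0 : R) (b : 'I_n -> R)
    (U : 'I_n -> set (borelType X)) : (forall j, measurable (U j)) ->
  (\int[m]_x (b0 + \sum_(j < n) b j * \1_(U j) x)%:E)%E =
  (b0 * mass m setT + \sum_(j < n) b j * mass m (U j))%:E.
Proof.
move=> mU.
have iU j : m.-integrable setT (fun x => (\1_(U j) x)%:E).
  by apply: integrable_indic => //; rewrite ltey_eq fin_num_measure.
have ibU j : m.-integrable setT (fun x => ((b j)%:E * (\1_(U j) x)%:E)%E).
  exact: integrableZl.
under eq_integral do rewrite EFinD -sumEFin.
rewrite integralD//; last 2 first.
- exact: finite_measure_integrable_cst.
- under [X in _.-integrable _ X]eq_fun do under eq_bigr do rewrite EFinM.
  exact: integrable_sum.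
under [X in (_ + X)%E]eq_integral do under eq_bigr do rewrite EFinM.
rewrite integral_sum// (integral_cst m measurableT) EFinD EFinM.
rewrite -(massE m measurableT); congr (_ + _)%E.
rewrite -sumEFin; apply: eq_bigr => j _.
by rewrite integralZl// integral_indic// setIT EFinM -(massE m (mU j)).
Qed.

End InnerRegular.

Section OpenStep.
Context {R : realType} {X : ptopologicalType}.
Variables (n : nat) (U : 'I_n -> set X).
Hypothesis dU : forall i j, i != j -> U i `&` U j = set0.

(** The value b j on U j and b0 elsewhere, when the U j are disjoint; written as
    a sum so that linear functionals apply to it directly. *)
Definition open_step (b0 : R) (b : 'I_n -> R) (x : X) : R :=
  b0 + \sum_(j < n) (b j - b0) * \1_(U j) x.

Lemma open_step_in b0 b j x : U j x -> open_step b0 b x = b j.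
Proof.
move=> Ujx; rewrite /open_step (bigD1 j)//= big1 => [|i ij].
  by rewrite indicE mem_set// mulr1 addr0 subrKC.
rewrite indicE memNset ?mulr0// => Uix.
by have : (U i `&` U j) x by []; rewrite dU.
Qed.

Lemma open_step_out b0 b x : (forall j, ~ U j x) -> open_step b0 b x = b0.
Proof.
move=> nU; rewrite /open_step big1 ?addr0// => j _.
by rewrite indicE memNset ?mulr0//; exact: nU.
Qed.

Lemma open_step_comp (G : R -> R) b0 b x :
  G (open_step b0 b x) = open_step (G b0) (G \o b) x.
Proof.
have [[j Ux]|nU] := pselect (exists j, U j x).
  by rewrite !(open_step_in _ _ Ux).
by rewrite !open_step_out// => j Ux; apply: nU; exists j.
Qed.

Lemma open_step_lsc b0 b : (forall j, open (U j)) -> (forall j, b0 <= b j) ->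
  lower_semicontinuous (EFin \o open_step b0 b).
Proof.
move=> oU b0b x t; rewrite /= lte_fin => tx.
have ge y : b0 <= open_step b0 b y.
  have [[j Uy]|nU] := pselect (exists j, U j y).
    by rewrite (open_step_in _ _ Uy).
  by rewrite open_step_out// => j Uy; apply: nU; exists j.
have [[j Ux]|nU] := pselect (exists j, U j x).
  exists (U j); first exact: open_nbhs_nbhs.
  by move=> y Uy; rewrite lte_fin (open_step_in _ _ Uy) -(open_step_in b0 b Ux).
exists setT; first exact: filterT.
move=> y _; rewrite lte_fin; apply: lt_le_trans (ge y).
by rewrite -(open_step_out b0 b (x := x))// => j Ux; apply: nU; exists j.
Qed.

Lemma open_step_admissible F b0 b :
  (forall j, open (U j)) -> (forall j, b0 <= b j) ->
  Fcirc F b0 \is a fin_num -> (forall j, Fcirc F (b j) \is a fin_num) ->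
  simple_lsc_admissible F (open_step b0 b).
Proof.
move=> oU b0b f0 fb; split.
- apply: (@sub_finite_set _ _ (b0 |` range b)).
    move=> _ [x _ <-]; have [[j Ux]|nU] := pselect (exists j, U j x).
      by right; exists j => //; rewrite (open_step_in _ _ Ux).
    by left; rewrite open_step_out// => j Ux; apply: nU; exists j.
  by rewrite finite_setU; split => //; exact: finite_image.
- exact: open_step_lsc.
- exists (`|Fcirc_real F b0| + \sum_(j < n) `|Fcirc_real F (b j)|) => x.
  have [[j Ux]|nU] := pselect (exists j, U j x).
    rewrite (open_step_in _ _ Ux) Fcirc_realE// lee_fin.
    by rewrite (bigD1 j)//= addrCA lerDl addr_ge0// sumr_ge0.
  rewrite open_step_out; last by move=> j Ux; apply: nU; exists j.
  by rewrite Fcirc_realE// lee_fin lerDl sumr_ge0.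
Qed.

End OpenStep.

Import HBSimple HBNNSimple.

Section Transfer.
Context {R : realType} {X : ptopologicalType}.
Hypothesis hX : hausdorff_space X.
Variable L : (X -> R) -> R.
Hypothesis HL : positive_functional L.

(** On open sets [L] dominates [g], which bounds L (U j) from below only. The
    upper bound comes from the other neighbourhoods: they are disjoint from U j,
    their masses are bounded from below, and the total masses agree. *)
Lemma open_separation_mass (g : {borel_measure X -> R}) n (idx : borelType X -> nat)
    (K U : 'I_n -> set X) (e : R) :
  (forall G, open G -> mass g G <= L \1_G) -> L (fun=> 1) = mass g setT ->
  measurable_fun setT idx -> (forall x, (idx x < n)%N) -> 0 <= e ->
  (forall j, compact (K j)) -> (forall j, K j `<=` U j) ->
  (forall j, open (U j)) -> (forall i j, i != j -> U i `&` U j = set0) ->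
  (forall j : 'I_n, mass g (idx @^-1` [set (j : nat)]) <= mass g (K j) + e) ->
  forall j : 'I_n, L \1_(U j) <= mass g (idx @^-1` [set (j : nat)]) + n%:R * e.
Proof.
move=> gL gT midx idx_lt e0 cK KU oU dU gK j.
have lo (i : 'I_n) : mass g (idx @^-1` [set (i : nat)]) - e <= L \1_(U i).
  rewrite lerBlDr; apply: le_trans (gK i) _; rewrite lerD2r.
  apply: le_trans (gL _ (oU i)).
  by apply: mass_le; [exact: compact_borel|exact: open_borel|exact: KU].
have := pf_sum_disjoint HL dU; rewrite gT -(mass_fibers g midx idx_lt).
rewrite (bigD1 j)//= [in leRHS](bigD1 j)//=.
have : \sum_(i < n | i != j) mass g (idx @^-1` [set (i : nat)]) - n%:R * e <=
    \sum_(i < n | i != j) L \1_(U i).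
  apply: le_trans (_ :
      \sum_(i < n | i != j) (mass g (idx @^-1` [set (i : nat)]) - e) <= _).
    rewrite sumrB lerD2l lerN2 sumr_const -[leLHS]mulr_natl.
    by apply: ler_wpM2r => //; rewrite ler_nat -[leqRHS]card_ord max_card.
  by apply: ler_sum => i _; exact: lo.
lra.
Qed.

Definition dual_part (F : R -> \bar R) (mu : {borel_measure X -> R})
    (phi : X -> R) : R :=
  fine (\int[mu]_x Fcirc F (phi x))%E.

Lemma dual_partE (F : R -> \bar R) (mu : {borel_measure X -> R}) (phi : X -> R) :
  simple_lsc_admissible F phi ->
  (\int[mu]_x Fcirc F (phi x))%E = (dual_part F mu phi)%:E.
Proof.
move=> adm; rewrite fineK//.
under eq_integral do rewrite (Fcirc_admissibleE _ adm).
by apply: integrable_fin_num => //; exact: (admissible_integrable mu _ adm).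
Qed.

Lemma dual_part_open_step (F : R -> \bar R) (mu : {borel_measure X -> R}) n
    (U : 'I_n -> set X) b0 (b : 'I_n -> R) :
  (forall j, open (U j)) -> (forall i j, i != j -> U i `&` U j = set0) ->
  simple_lsc_admissible F (open_step U b0 b) ->
  dual_part F mu (open_step U b0 b) = Fcirc_real F b0 * mass mu setT +
    \sum_(j < n) (Fcirc_real F (b j) - Fcirc_real F b0) * mass mu (U j).
Proof.
move=> oU dU adm; rewrite /dual_part.
under eq_integral do rewrite (Fcirc_admissibleE _ adm) open_step_comp//.
by rewrite integral_step// => j; exact: open_borel.
Qed.

(** The approximating function takes the value a j on an open neighbourhood of a
    compact part of the j-th piece and the smallest value elsewhere, which makes
    it lower semicontinuous; F° being nondecreasing, the loss in both terms has
    a controlled sign. *)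
Lemma lsc_approximation F (GF : Gamma F) (mu g : {borel_measure X -> R}) n
    (idx : borelType X -> nat) (a : nat -> R) (e : R) :
  inner_regular mu -> inner_regular g ->
  (forall G, open G -> mass g G <= L \1_G) -> L (fun=> 1) = mass g setT ->
  measurable_fun setT idx -> (forall x, (idx x < n)%N) ->
  (forall j, Fcirc F (a j) \is a fin_num) -> 0 < e ->
  exists2 phi, simple_lsc_admissible F phi &
    partition_value F g mu n idx a <= dual_part F mu phi - L phi + e.
Proof.
move=> rmu rg gL gT midx idx_lt afin e0.
have n0 : (0 < n)%N by exact: leq_ltn_trans (idx_lt point).
have [j0 amin] : exists j0 : 'I_n, forall j : 'I_n, a j0 <= a j.
  have [j0 _ h] := @arg_minP _ _ _ (Ordinal n0) xpredT (fun j : 'I_n => a j) isT.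
  by exists j0 => j; exact: h.
set a0 := a j0; pose b (j : 'I_n) := a j.
have Fr_le j : Fcirc_real F a0 <= Fcirc_real F (b j).
  by have [] := Fcirc_fin_le GF (amin j) (afin j0).
(* [S] multiplies the error [dl] of the masses in the final estimate. *)
pose S := \sum_(j < n) (Fcirc_real F (b j) - Fcirc_real F a0) +
          n%:R * \sum_(j < n) (b j - a0).
have S0 : 0 <= S.
  by rewrite addr_ge0 ?mulr_ge0// sumr_ge0// => j _; rewrite subr_ge0//; exact: amin.
pose dl := e / (S + 1).
have dl0 : 0 < dl by rewrite divr_gt0//; lra.
have [K [U [cK KUA oU dU KA]]] := separated_partition hX n rmu rg midx dl0.
have KU j : K j `<=` U j by have [] := KUA j.
have adm := open_step_admissible dU oU amin (afin j0) (fun j => afin j).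
exists (open_step U a0 b) => //.
rewrite (dual_part_open_step mu oU dU adm) (pf_step HL) gT.
rewrite -!(mass_fibers _ midx idx_lt) /partition_value.
pose A (j : nat) := idx @^-1` [set j].
have mA j : measurable (A j) by exact: measurable_fiber.
have mU (j : 'I_n) : mass mu (A j) - dl <= mass mu (U j).
  rewrite lerBlDr; apply: le_trans (KA j).1 _; rewrite lerD2r.
  by apply: mass_le; [exact: compact_borel|exact: open_borel|exact: KU].
have LU (j : 'I_n) : L \1_(U j) <= mass g (A j) + n%:R * dl.
  apply: (@open_separation_mass g n idx K) => //; first exact: ltW.
  by move=> i; have [] := KA i.
rewrite !mulr_sumr.
have h1 :
    \sum_(j < n)
      (Fcirc_real F (b j) - Fcirc_real F a0) * (mass mu (A j) - dl) <=
    \sum_(j < n) (Fcirc_real F (b j) - Fcirc_real F a0) * mass mu (U j).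
  by apply: ler_sum => j _; rewrite ler_wpM2l// subr_ge0.
have h2 : \sum_(j < n) (b j - a0) * L \1_(U j) <=
    \sum_(j < n) (b j - a0) * (mass g (A j) + n%:R * dl).
  by apply: ler_sum => j _; rewrite ler_wpM2l// subr_ge0; exact: amin.
have h3 : S * dl <= e.
  by rewrite /dl mulrCA ger_pMr// ler_pdivrMr; lra.
have h4 : \sum_(j < n) (Fcirc_real F (a j) * mass mu (A j) - a j * mass g (A j)) =
   \sum_(j < n) Fcirc_real F a0 * mass mu (A j) +
   \sum_(j < n) (Fcirc_real F (b j) - Fcirc_real F a0) * (mass mu (A j) - dl) -
   (\sum_(j < n) a0 * mass g (A j) +
    \sum_(j < n) (b j - a0) * (mass g (A j) + n%:R * dl)) + S * dl.
  rewrite /S mulrDl mulr_suml mulrAC mulr_sumr.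
  rewrite -!big_split/= -sumrB -big_split/=; apply: eq_bigr => j _.
  rewrite /b; ring.
rewrite -/A h4; lra.
Qed.

(** A simple function below [c] is moved to open sets in the same way: near a
    compact part of the piece where it equals a j, [c] exceeds a j - dl by lower
    semicontinuity. *)
Lemma cost_regularisation (g : {borel_measure X -> R}) (c : X -> \bar R) (C : R) :
  inner_regular g -> (forall x, 0 <= c x)%E -> lower_semicontinuous c ->
  (forall G, open G -> mass g G <= L \1_G) ->
  (forall f, bounded_fun_set f -> (forall x, (f x)%:E <= c x)%E -> L f <= C) ->
  (\int[g]_x c x <= C%:E)%E.
Proof.
move=> rg c0 lc gL HC.
rewrite ge0_integralTE//; apply: ge_ereal_sup => _ [h hc <-].
rewrite -integralT_nnsfun.
have [n [idx [a [midx idx_lt ha ra]]]] :=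
  finite_range_indexed (measurable_funPT h) (fimfunP h).
have a_ge0 j : 0 <= a j by have [x _ <-] := ra j.
under eq_integral do rewrite ha.
rewrite (integral_indexed g midx idx_lt a) lee_fin.
pose S := mass g setT + \sum_(j < n) a j.
have S0 : 0 <= S by rewrite addr_ge0 ?mass_ge0// sumr_ge0.
apply/ler_addgt0Pr => e e0; pose dl := e / (S + 1).
have dl0 : 0 < dl by rewrite divr_gt0//; lra.
have [K [U [cK KUA oU dU KA]]] := separated_partition hX n rg rg midx dl0.
pose V (j : 'I_n) := U j `&` [set x | ((a j - dl)%:E < c x)%E].
have oV j : open (V j) by apply: openI => //; move/lower_semicontinuousP : lc; exact.
have dV i j : i != j -> V i `&` V j = set0.
  by move=> ij; rewrite /V setIACA dU// set0I.
have KV (j : 'I_n) : K j `<=` V j.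
  move=> x Kx; have [KU KAx] := KUA j; split; first exact: KU.
  have := hc x; rewrite ha (KAx _ Kx) /=; apply: lt_le_trans.
  by rewrite lte_fin; lra.
pose b (j : 'I_n) := Num.max (a j - dl) 0.
have b0 j : 0 <= b j by rewrite le_max lexx orbT.
have fc x : ((open_step V 0 b x)%:E <= c x)%E.
  have [[j Vx]|nV] := pselect (exists j, V j x); last first.
    by rewrite open_step_out// => j Vx; apply: nV; exists j.
  rewrite (open_step_in dV _ _ Vx) /b; case: (lerP (a j - dl) 0) => _ //.
  by apply: ltW; have [] := Vx.
have bf : bounded_fun_set (open_step V 0 b).
  apply: bounded_add; first exact: bounded_cst.
  by apply: bounded_sum => j; apply: bounded_scale; exact: bounded_indic.
have := HC _ bf fc; rewrite (pf_step HL) mul0r add0r => LC.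
have key (j : 'I_n) : a j * fine (g (idx @^-1` [set (j : nat)])) <=
    (b j - 0) * L \1_(V j) + dl * (mass g (idx @^-1` [set (j : nat)]) + a j).
  rewrite -/(mass _ _) subr0; set m := mass g _.
  have mK : m - dl <= L \1_(V j).
    rewrite lerBlDr; apply: le_trans (KA j).1 _; rewrite lerD2r.
    apply: le_trans (gL _ (oV j)).
    by apply: mass_le; [exact: compact_borel|exact: open_borel|exact: KV].
  have m0 : 0 <= m := mass_ge0 _ _.
  have := ler_wpM2l (b0 j) mK.
  have aj := a_ge0 j.
  rewrite /b; case: (lerP (a j - dl) 0) => h1 h2; nra.
apply: le_trans (ler_sum _ (fun j _ => key j)) _.
rewrite big_split/= -mulr_sumr big_split/= (mass_fibers g midx idx_lt) -/S.
apply: lerD => //; rewrite /dl mulrAC -mulrA ger_pMr// ler_pdivrMr; lra.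
Qed.

End Transfer.

(** * Perturbation of the dual problem *)

Section AdmissibleConvexity.
Context {R : realType} {X : ptopologicalType}.
Variable F : R -> \bar R.
Hypothesis GF : Gamma F.

Lemma admissibleP (phi : X -> R) : simple_lsc_admissible F phi <->
  [/\ finite_set (range phi), lower_semicontinuous (EFin \o phi) &
    forall x, Fcirc F (phi x) \is a fin_num].
Proof.
split=> [adm|[fphi lphi finphi]].
  by have [? ? _] := adm; split => // x; exact: admissible_fin adm.
split => //; have /finite_seqP[s sE] := fphi.
exists (\sum_(v <- s) `|Fcirc_real F v|) => x.
rewrite Fcirc_realE// lee_fin (big_rem (phi x))/=; last first.
  by have : range phi (phi x) by [exists x]; rewrite sE.
by rewrite lerDl sumr_ge0.
Qed.

Lemma admissible_bounded (phi : X -> R) : simple_lsc_admissible F phi ->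
  bounded_fun_set phi.
Proof.
move=> [/finite_seqP[s sE] _ _]; exists (\sum_(v <- s) `|v|) => x.
rewrite (big_rem (phi x))/=; last first.
  by have : range phi (phi x) by [exists x]; rewrite sE.
by rewrite lerDl sumr_ge0.
Qed.

Lemma admissible_cst a : Fcirc F a \is a fin_num ->
  simple_lsc_admissible F (fun _ : X => a).
Proof.
move=> fa; apply/admissibleP; split => //.
- by apply: (@sub_finite_set _ _ [set a]) => [_ [x _ <-]//|]; exact: finite_set1.
- by move=> x t ta; exists setT; first exact: filterT.
Qed.

Lemma admissible_convex (phi psi : X -> R) l : 0 <= l <= 1 ->
  simple_lsc_admissible F phi -> simple_lsc_admissible F psi ->
  simple_lsc_admissible F (fun x => l * phi x + (1 - l) * psi x).
Proof.
move=> l01 /admissibleP[f1 lsc1 fin1] /admissibleP[f2 lsc2 fin2].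
have /andP[l0 l1] := l01; apply/admissibleP; split.
- apply: (@sub_finite_set _ _
    [set l * a + (1 - l) * b | a in range phi & b in range psi]).
    move=> _ [x _ <-]; exists (phi x); first by exists x.
    by exists (psi x) => //; exists x.
  exact: finite_image2.
- move=> x t; rewrite /= lte_fin => tx.
  pose d := l * phi x + (1 - l) * psi x - t; have d0 : 0 < d by rewrite /d; lra.
  have [|V1 xV1 h1] := lsc1 x (phi x - d); first by rewrite lte_fin; lra.
  have [|V2 xV2 h2] := lsc2 x (psi x - d); first by rewrite lte_fin; lra.
  exists (V1 `&` V2); first exact: filterI.
  move=> y [/h1 + /h2]; rewrite !lte_fin => {}h1 {}h2.
  have [l0'|l0'] := ltP 0 l.
    have := ltr_pM2l l0' (phi x - d) (phi y); rewrite h1 => {}h1.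
    have : (1 - l) * (psi x - d) <= (1 - l) * psi y by apply: ler_wpM2l; lra.
    by move: h1; rewrite /d; lra.
  have -> : l = 0 by lra.
  by move: h2; rewrite /d (_ : l = 0); lra.
- by move=> x; have [] := Fcirc_concave GF l01 (fin1 x) (fin2 x).
Qed.

Lemma dual_part_concave (mu : {borel_measure X -> R}) (phi psi : X -> R) l :
  0 <= l <= 1 -> simple_lsc_admissible F phi -> simple_lsc_admissible F psi ->
  l * dual_part F mu phi + (1 - l) * dual_part F mu psi <=
  dual_part F mu (fun x => l * phi x + (1 - l) * psi x).
Proof.
move=> l01 adm1 adm2; have adm3 := admissible_convex l01 adm1 adm2.
rewrite -lee_fin EFinD !EFinM -!dual_partE//.
under eq_integral do rewrite (Fcirc_admissibleE _ adm1).
under [X in (_ + _ * X <= _)%E]eq_integral do rewrite (Fcirc_admissibleE _ adm2).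
under [X in (_ <= X)%E]eq_integral do rewrite (Fcirc_admissibleE _ adm3).
have i1 := admissible_integrable mu (Fcirc_real F) adm1.
have i2 := admissible_integrable mu (Fcirc_real F) adm2.
rewrite -!integralZl// -integralD//; last 2 first.
- exact: integrableZl.
- exact: integrableZl.
apply: le_integral => //.
- by apply: integrableD => //; exact: integrableZl.
- exact: (admissible_integrable mu (Fcirc_real F) adm3).
- move=> x _; rewrite -!EFinM -EFinD lee_fin.
  have fin1 := admissible_fin x adm1; have fin2 := admissible_fin x adm2.
  by have [] := Fcirc_concave GF l01 fin1 fin2.
Qed.

Lemma dual_part0_ge0 (mu : {borel_measure X -> R}) :
  0 <= dual_part F mu (fun _ : X => 0).
Proof.
apply: fine_ge0; apply: integral_ge0 => x _.
by have [f0 h] := Fcirc0_fin GF (lexx 0); rewrite Fcirc_realE.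
Qed.

End AdmissibleConvexity.

Section DualFunctional.
Context {R : realType} {X1 X2 : ptopologicalType}.
Variables (F1 F2 : R -> \bar R) (c : X1 * X2 -> \bar R).
Variables (mu1 : {borel_measure X1 -> R}) (mu2 : {borel_measure X2 -> R}).
Hypotheses (GF1 : Gamma F1) (GF2 : Gamma F2).
Hypothesis c_ge0 : forall x, (0 <= c x)%E.
Variables (d1 d2 dl : R).
Hypotheses (fd1 : Fcirc F1 d1 \is a fin_num) (fd2 : Fcirc F2 d2 \is a fin_num).
Hypotheses (dl0 : 0 < dl) (slack : forall x, ((d1 + d2 + dl)%:E <= c x)%E).

Definition dual_real (phi : (X1 -> R) * (X2 -> R)) : R :=
  dual_part F1 mu1 phi.1 + dual_part F2 mu2 phi.2.

Definition admissible_pair (phi : (X1 -> R) * (X2 -> R)) :=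
  simple_lsc_admissible F1 phi.1 /\ simple_lsc_admissible F2 phi.2.

Lemma dual_functionalE phi : admissible_pair phi ->
  dual_functional F1 F2 mu1 mu2 phi = (dual_real phi)%:E.
Proof. by move=> [adm1 adm2]; rewrite /dual_functional !dual_partE. Qed.

Variable D : R.
Hypothesis D_ub : forall phi, Phi F1 F2 c phi -> dual_real phi <= D.

(** Difference quotients bounding from above the one-sided derivative at t = 0 of
    minus the dual value of the cost c + t psi. *)
Definition perturbation_slopes (psi : X1 * X2 -> R^o) : set R :=
  [set r | exists (t : R) phi, [/\ 0 < t, admissible_pair phi,
    forall x, ((phi.1 x.1 + phi.2 x.2 - t * (psi x : R))%:E <= c x)%E &
    r = (D - dual_real phi) / t]].

Let phi0 : (X1 -> R) * (X2 -> R) := (fun=> d1, fun=> d2).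

Let adm0 : admissible_pair phi0.
Proof. by split; exact: admissible_cst. Qed.

Lemma perturbation_slopes_ge0 (psi : X1 * X2 -> R^o) (t : R) :
  (forall x, 0 <= psi x :> R) ->
  0 < t -> perturbation_slopes psi ((D - dual_real phi0) / t).
Proof.
move=> psi0 t0; exists t, phi0; split => // x /=.
apply: le_trans (slack x); rewrite lee_fin.
have p0 : 0 <= psi x :> R := psi0 x.
have := mulr_ge0 (ltW t0) p0; move: (psi x : R) => p; have := dl0; lra.
Qed.

(** Concavity of the dual functional makes the infimum of the slopes sublinear,
    and the bound D on the feasible values makes it nonnegative at 0. It is finite
    because the constant pair (d1, d2) stays feasible under small perturbations. With
    t = 1 and psi = phi1 + phi2 - f, every pair [phi] is feasible for c + psi,
    which gives the inequality. *)
Lemma dual_perturbation_functional : exists L : (X1 * X2 -> R) -> R,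
  positive_functional L /\ forall phi f, admissible_pair phi ->
    bounded_fun_set f -> (forall x, (f x)%:E <= c x)%E ->
    dual_real phi - (L (fun x => phi.1 x.1) + L (fun x => phi.2 x.2)) + L f <= D.
Proof.
have [||||||f [fD fZ fS]] := @cone_functional R (X1 * X2 -> R^o)%type
    (@bounded_fun_set R (X1 * X2)%type) _ _ perturbation_slopes.
- by move=> x y; exact: bounded_add.
- by move=> t x; exact: bounded_scale.
- move=> psi [M Mpsi]; have M0 : 0 <= M by exact: le_trans (Mpsi point).
  exists ((D - dual_real phi0) / (dl / (M + 1))).
  have t0 : 0 < dl / (M + 1) by rewrite divr_gt0//; lra.
  exists (dl / (M + 1)), phi0; split => // x /=.
  apply: le_trans (slack x); rewrite lee_fin.
  suff : dl / (M + 1) * - psi x <= dl by lra.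
  rewrite mulrAC ler_pdivrMr; last lra.
  rewrite ler_pM2l//; have := Mpsi x; rewrite ler_norml => /andP[]; lra.
- move=> u psi r u0 _ [t [phi [t0 adm phic ->]]].
  exists (t / u), phi; split => //; first exact: divr_gt0.
    move=> x; have h := phic x.
    rewrite -(_ : t / u * (u * (psi x : R)) = t * psi x) in h; first exact: h.
    by rewrite mulrA divfK ?gt_eqF.
  by rewrite invf_div mulrCA.
- move=> psi psi' _ _ _ _ [t [phi [t0 adm phic ->]]] [t' [phi' [t0' adm' phic' ->]]].
  (* The pair l phi + (1 - l) phi' is feasible for c + l t (psi + psi'), since
     the weights satisfy l t = (1 - l) t'. *)
  pose l := t' / (t + t'); have tt : 0 < t + t' by exact: addr_gt0.
  have l01 : 0 <= l <= 1 by rewrite divr_ge0 ?ler_pdivrMr//=; lra.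
  have lE : 1 - l = t / (t + t') by rewrite /l; field; rewrite gt_eqF.
  pose phi'' : (X1 -> R) * (X2 -> R) := (fun x => l * phi.1 x + (1 - l) * phi'.1 x,
                 fun x => l * phi.2 x + (1 - l) * phi'.2 x).
  have adm'' : admissible_pair phi''.
    have [a1 a2] := adm; have [a1' a2'] := adm'.
    by split; apply: admissible_convex.
  exists ((D - dual_real phi'') / (l * t)).
    have lt0 : 0 < l * t by rewrite mulr_gt0// divr_gt0.
    exists (l * t), phi''; split => // x.
    have := phic x; have := phic' x.
    have : ((psi + psi') x : R) = (psi x : R) + (psi' x : R) by [].
    move: (psi x : R) (psi' x : R) ((psi + psi') x : R) => p p' q ->.
    case: (c x) => [v||]; rewrite ?leey// !lee_fin.
    move=> h' h.
    have e1 : l * t = (1 - l) * t' by rewrite lE /l; ring.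
    have /andP[l0 l1] := l01; have l1' : 0 <= 1 - l by lra.
    have := ler_wpM2l l0 h; have := ler_wpM2l l1' h'.
    have e2 : l * t * p' = (1 - l) * t' * p' by rewrite e1.
    rewrite /phi''/=; lra.
  have h1 : l * dual_part F1 mu1 phi.1 + (1 - l) * dual_part F1 mu1 phi'.1 <=
    dual_part F1 mu1 phi''.1 := dual_part_concave GF1 mu1 l01 adm.1 adm'.1.
  have h2 : l * dual_part F2 mu2 phi.2 + (1 - l) * dual_part F2 mu2 phi'.2 <=
    dual_part F2 mu2 phi''.2 := dual_part_concave GF2 mu2 l01 adm.2 adm'.2.
  have lt0 : 0 < l * t by rewrite mulr_gt0// divr_gt0.
  rewrite ler_pdivrMr//.
  have -> : ((D - dual_real phi) / t + (D - dual_real phi') / t') * (l * t) =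
      l * (D - dual_real phi) + (1 - l) * (D - dual_real phi').
    rewrite lE /l; field; rewrite !gt_eqF//.
  by rewrite /dual_real; lra.
- move=> r [t [phi [t0 [adm1 adm2] phic ->]]].
  apply: divr_ge0; last exact: ltW.
  rewrite subr_ge0; apply: D_ub; split => // x1 x2; have := phic (x1, x2).
  by rewrite [(0 : _ -> _) _]/(0 : R) mulr0 subr0.
exists (fun g => - f g).
have HL : positive_functional (fun g => - f g).
  split.
  - by move=> g h bg bh; rewrite -opprD -fD.
  - by move=> t g bg; rewrite mulrN -fZ.
  - (* For a nonnegative perturbation the constant pair is feasible for all t;
       let t tend to infinity. *)
    move=> g bg g0; rewrite oppr_ge0; apply/ler_addgt0Pr => e e0; rewrite add0r.
    pose C := `|D - dual_real phi0| + 1.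
    have C0 : 0 < C by rewrite ltr_pwDr.
    apply: le_trans (fS _ _ bg (perturbation_slopes_ge0 g0 (divr_gt0 C0 e0))) _.
    rewrite invf_div mulrCA ger_pMr// ler_pdivrMr// mul1r.
    by apply: le_trans (ler_norm _) _; rewrite lerDl.
split => // phi g [adm1 adm2] bg gc.
have b1 : bounded_fun_set (fun x : X1 * X2 => phi.1 x.1).
  by have [M hM] := admissible_bounded adm1; exists M.
have b2 : bounded_fun_set (fun x : X1 * X2 => phi.2 x.2).
  by have [M hM] := admissible_bounded adm2; exists M.
have bs := bounded_add b1 b2.
have bN : bounded_fun_set (fun x => -1 * g x) by exact: bounded_scale.
pose psi := ((fun x : X1 * X2 => phi.1 x.1) \+ (fun x => phi.2 x.2)) \+
  (fun x => -1 * g x).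
have : f psi <= D - dual_real phi.
  apply: fS; first exact: bounded_add.
  exists 1, phi; split => //; last by rewrite divr1.
  by move=> x; apply: le_trans (gc x); rewrite lee_fin /psi/=; lra.
have := pf_add HL bs bN; rewrite -/psi (pf_add HL b1 b2) (pf_scale HL _ bg); lra.
Qed.

End DualFunctional.

(** * Coercivity and strong duality *)

Section MarginalTightness.
Context {R : realType} {X : ptopologicalType}.
Hypothesis hX : hausdorff_space X.
Variables (F : R -> \bar R) (mu : {borel_measure X -> R}).
Hypotheses (GF : Gamma F) (rmu : inner_regular mu).
Variables (L : (X -> R) -> R) (C : R).
Hypothesis HL : positive_functional L.
Hypothesis L_dual : forall phi, simple_lsc_admissible F phi ->
  dual_part F mu phi - L phi <= C.

(** Test with the function equal to 0 on a neighbourhood of a compact set [K] and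
    to - M elsewhere: superlinearity makes F°(- M) finite for every [M], so that
    choosing [K] after [M] keeps the entropy term bounded while [M] multiplies
    the mass that [L] puts away from [K]. *)
Lemma superlinear_tight : recession F = +oo%E -> forall e, 0 < e ->
  exists2 K, compact K & forall U, open U -> K `<=` U -> L \1_(~` U) <= e.
Proof.
move=> rF e e0; pose M := (`|C| + 1) / e.
have M0 : 0 < M by rewrite divr_gt0// ltr_wpDl.
have fM : Fcirc F (- M) \is a fin_num.
  have : (M%:E < recession F)%E by rewrite rF ltry.
  rewrite (recessionE GF) => /ereal_sup_gt[_ [a fa <-]]; rewrite lte_fin => Ma.
  by have [] := Fcirc_fin_le GF (_ : a <= - M) fa => //; lra.
have [f0 Fr0] := Fcirc0_fin GF (lexx 0).
pose N := `|Fcirc_real F (- M)|; have N0 : 0 <= N by exact: normr_ge0.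
have dl0 : 0 < (N + 1)^-1 by rewrite invr_gt0; lra.
have [K [cK _ Kmass]] := rmu measurableT dl0; exists K => // U oU KU.
pose W (j : 'I_1) := U; pose b (j : 'I_1) : R := 0.
have dW (i j : 'I_1) : i != j -> W i `&` W j = set0 by rewrite !ord1.
have adm : simple_lsc_admissible F (open_step W (- M) b).
  by apply: open_step_admissible => // j; rewrite /b; lra.
have := L_dual adm.
rewrite (dual_part_open_step mu (fun=> oU) dW adm) (pf_step HL) !big_ord1.
have -> : L (fun=> 1) = L \1_U + L \1_(~` U).
  by rewrite -(pf_indicU HL) ?setICr// setUv pf_indicT.
rewrite /W /b => h.
have mU : mass mu setT - mass mu U <= (N + 1)^-1.
  rewrite lerBlDl; apply: le_trans Kmass _; rewrite lerD2r.
  by apply: mass_le; [exact: compact_borel|exact: open_borel|].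
have mU0 : 0 <= mass mu setT - mass mu U.
  by rewrite subr_ge0; apply: mass_le => //; exact: open_borel.
have FrM : - N <= Fcirc_real F (- M) by rewrite lerNl ler_normr lexx orbT.
have h1 : - N * (mass mu setT - mass mu U) <=
    Fcirc_real F (- M) * (mass mu setT - mass mu U) by exact: ler_wpM2r.
have h2 : N * (mass mu setT - mass mu U) <= 1.
  apply: le_trans (ler_wpM2l N0 mU) _; rewrite ler_pdivrMr; lra.
have h3 : 0 <= Fcirc_real F 0 * mass mu U by rewrite mulr_ge0// mass_ge0.
have h4 : C <= `|C| by exact: ler_norm.
have : M * L \1_(~` U) <= M * e by rewrite [M * e]divfK ?gt_eqF//; lra.
by rewrite ler_pM2l.
Qed.

End MarginalTightness.

Section StrictFeasibility.
Context {R : realType} {X1 X2 : ptopologicalType}.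
Variables (F1 F2 : R -> \bar R) (c : X1 * X2 -> \bar R).
Hypotheses (GF1 : Gamma F1) (GF2 : Gamma F2) (c_ge0 : forall x, (0 <= c x)%E).

Lemma recession_gt0 F : Gamma F -> (0 < recession F)%E ->
  exists2 a : R, Fcirc F a \is a fin_num & a < 0.
Proof.
move=> GF; rewrite (recessionE GF) => /ereal_sup_gt[_ [a fa <-]].
by rewrite lte_fin oppr_gt0 => a0; exists a.
Qed.

(** The three nonnegative terms of the coercivity condition cannot all vanish;
    whichever is positive provides the slack. *)
Lemma strict_feasibility : coercive F1 F2 c -> exists d1 d2 dl : R,
  [/\ Fcirc F1 d1 \is a fin_num, Fcirc F2 d2 \is a fin_num, 0 < dl &
    forall x, ((d1 + d2 + dl)%:E <= c x)%E].
Proof.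
move=> co.
have z1 := (Fcirc0_fin GF1 (lexx 0)).1; have z2 := (Fcirc0_fin GF2 (lexx 0)).1.
have r1 : (0 <= recession F1)%E by rewrite (recessionE GF1) recession_sup_ge0.
have r2 : (0 <= recession F2)%E by rewrite (recessionE GF2) recession_sup_ge0.
have i0 : (0 <= ereal_inf (range c))%E by apply: le_ereal_inf_tmp => _ [x _ <-].
have [p1|n1] := ltP 0%E (recession F1).
  have [a fa a0] := recession_gt0 GF1 p1; exists a, 0, (- a); split => //; first lra.
  by move=> x; rewrite addr0 subrr.
have [p2|n2] := ltP 0%E (recession F2).
  have [a fa a0] := recession_gt0 GF2 p2; exists 0, a, (- a); split => //; first lra.
  by move=> x; rewrite add0r subrr.
have e1 : recession F1 = 0%E by apply/eqP; rewrite eq_le n1 r1.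
have e2 : recession F2 = 0%E by apply/eqP; rewrite eq_le n2 r2.
case: co => [[]|[]]; first by rewrite e1.
rewrite e1 e2 !add0e => ip _.
have [dl dl0 dli] : exists2 dl : R, 0 < dl & (dl%:E <= ereal_inf (range c))%E.
  case: (ereal_inf _) ip => [r||]//; first by rewrite lte_fin; exists r.
  by exists 1; rewrite ?leey.
exists 0, 0, dl; split => // x; rewrite !add0r.
by apply: le_trans dli _; apply: ereal_inf_lbound; exists x.
Qed.

End StrictFeasibility.

Lemma inner_regular_pushforward {R : realType} (Y X : ptopologicalType)
    (p : Y -> X) (m : {borel_measure Y -> R}) (g : {borel_measure X -> R}) :
  hausdorff_space Y -> hausdorff_space X -> continuous p -> inner_regular m ->
  (g : set (borelType X) -> \bar R) =
    pushforward m (p : borelType Y -> borelType X) -> inner_regular g.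
Proof.
move=> hY hX cp rm ge B e mB e0; have mp := continuous_borel_measurable cp.
have mpre (A : set (borelType X)) : measurable A ->
    measurable (p @^-1` A : set (borelType Y)).
  by move=> mA; rewrite -[X in measurable X]setTI; exact: mp.
have [K [cK KB h]] := rm _ e (mpre B mB) e0.
have cK' : compact (p @` K).
  by apply: continuous_compact => //; exact: continuous_subspaceT.
exists (p @` K); split => //; first by move=> _ [x Kx <-]; exact: KB.
rewrite /mass ge; apply: le_trans h _; rewrite lerD2r; apply: mass_le.
- exact: (compact_borel hY).
- by apply: mpre; exact: compact_borel.
- by move=> x Kx; exists x.
Qed.

Section StrongDuality.
Context {R : realType} {X1 X2 : ptopologicalType}.
Variables (F1 F2 : R -> \bar R) (c : X1 * X2 -> \bar R).
Variables (mu1 : {borel_measure X1 -> R}) (mu2 : {borel_measure X2 -> R}).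
Hypothesis setting : basic_setting F1 F2 c mu1 mu2.
Hypothesis co : coercive F1 F2 c.

Let GF1 := Gamma1 setting.
Let GF2 := Gamma2 setting.
Let h1 := hausdorff1 setting.
Let h2 := hausdorff2 setting.
Let c_ge0 := cost_ge0 setting.
Let c_lsc := cost_lsc setting.
Let rmu1 := radon_inner_regular h1 (radon1 setting).
Let rmu2 := radon_inner_regular h2 (radon2 setting).

Variable L : (X1 * X2 -> R) -> R.
Hypothesis HL : positive_functional L.
Variable D : R.
Hypothesis L_dual : forall phi f, admissible_pair F1 F2 phi ->
    bounded_fun_set f -> (forall x, (f x)%:E <= c x)%E ->
    dual_real F1 F2 mu1 mu2 phi -
      (L (fun x => phi.1 x.1) + L (fun x => phi.2 x.2)) + L f <= D.

Let L1 (f : X1 -> R) := L (f \o fst).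
Let L2 (f : X2 -> R) := L (f \o snd).

(** Superlinear entropies make both marginals of [L] tight, and a product of
    compact sets has arbitrarily small product neighbourhoods. Compact sublevels
    of [c] give tightness by Chebyshev's inequality applied to L. *)
Lemma functional_tight (e : R) : 0 < e ->
  exists2 K : set (X1 * X2), compact K &
    forall U, open U -> K `<=` U -> L \1_(~` U) <= e.
Proof.
move=> e0; have z1 := (Fcirc0_fin GF1 (lexx 0)).1.
have z2 := (Fcirc0_fin GF2 (lexx 0)).1.
have HL1 : positive_functional L1 := pf_comp fst HL.
have HL2 : positive_functional L2 := pf_comp snd HL.
have L0 : L (fun=> 0) = 0.
  rewrite -[RHS](mul0r (L (fun=> 0))) -(pf_scale HL _ (bounded_cst 0)).
  by congr (L _); apply/funext => x; rewrite mul0r.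
have b0 : @bounded_fun_set R (X1 * X2)%type (fun=> 0) by exact: bounded_cst.
have c0 x : ((0 : R)%:E <= c x)%E by [].
case: co => [[rF1 rF2]|[_ sublevel]].
- have H1 phi : simple_lsc_admissible F1 phi -> dual_part F1 mu1 phi - L1 phi <= D.
    move=> adm; have adm2 := @admissible_cst _ X2 _ _ z2.
    have := L_dual (phi := (phi, fun=> 0)) (conj adm adm2) b0 c0.
    have := dual_part0_ge0 GF2 mu2.
    by rewrite /dual_real/= L0 -/(L1 phi); lra.
  have H2 phi : simple_lsc_admissible F2 phi -> dual_part F2 mu2 phi - L2 phi <= D.
    move=> adm; have adm1 := @admissible_cst _ X1 _ _ z1.
    have := L_dual (phi := (fun=> 0, phi)) (conj adm1 adm) b0 c0.
    have := dual_part0_ge0 GF1 mu1.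
    by rewrite /dual_real/= L0 -/(L2 phi); lra.
  have e20 : 0 < e / 2 by rewrite divr_gt0.
  have [K1 cK1 T1] := superlinear_tight h1 GF1 rmu1 HL1 H1 rF1 e20.
  have [K2 cK2 T2] := superlinear_tight h2 GF2 rmu2 HL2 H2 rF2 e20.
  exists (K1 `*` K2); first exact: compact_setX.
  move=> U oU KU; have [A [B [oA oB KA KB ABU]]] := tube_lemma cK1 cK2 oU KU.
  have := T1 A oA KA; have := T2 B oB KB.
  suff : L \1_(~` U) <= L1 \1_(~` A) + L2 \1_(~` B) by lra.
  have bA : bounded_fun_set (\1_(~` A) \o fst : X1 * X2 -> R).
    by have [M hM] := @bounded_indic R X1 (~` A); exists M => x; exact: hM.
  have bB : bounded_fun_set (\1_(~` B) \o snd : X1 * X2 -> R).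
    by have [M hM] := @bounded_indic R X2 (~` B); exists M => x; exact: hM.
  rewrite /L1 /L2 -(pf_add HL bA bB); apply: (pf_le HL).
  + exact: bounded_indic.
  + exact: bounded_add.
  + move=> x /=; rewrite !indicE.
    have [xU|xU] := boolP (x \in ~` U); last by rewrite addr_ge0.
    have [xA|xA] := boolP (x.1 \in ~` A); first by rewrite lerDl.
    have [xB|xB] := boolP (x.2 \in ~` B); first by rewrite lerDr.
    exfalso; move: xU xA xB; rewrite !in_setC !negbK => /negP xU xA xB.
    by apply: xU; apply/mem_set; apply: ABU; split; exact: set_mem.
- have adm00 : admissible_pair F1 F2 (fun _ : X1 => 0, fun _ : X2 => 0).
    by split; exact: admissible_cst.
  have p1 := dual_part0_ge0 GF1 mu1; have p2 := dual_part0_ge0 GF2 mu2.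
  pose N := (`|D| + 1) / e; have N0 : 0 < N by rewrite divr_gt0// ltr_wpDl.
  exists [set x | (c x <= N%:E)%E]; first exact: sublevel.
  move=> U oU KU.
  have bN : bounded_fun_set (fun x : X1 * X2 => N * \1_(~` U) x).
    by apply: bounded_scale; exact: bounded_indic.
  have := L_dual adm00 bN; rewrite /dual_real/= !L0.
  rewrite (pf_scale HL _ (bounded_indic _)) => /(_ _)/=.
  have Nc x : ((N * \1_(~` U) x)%:E <= c x)%E.
    rewrite indicE; have [xU|xU] := boolP (x \in ~` U); last by rewrite mulr0.
    rewrite mulr1 leNgt; apply/negP => /ltW cN.
    by move: xU; rewrite in_setC => /negP; apply; apply/mem_set; exact: KU.
  move=> /(_ Nc) h; have D1 : D <= `|D| by exact: ler_norm.
  have : N * L \1_(~` U) <= N * e by rewrite [N * e]divfK ?gt_eqF//; lra.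
  by rewrite ler_pM2l.
Qed.

(** The inequality of the multiplier holds, with [gamma] in place of [L], for
    independent partitions of the two factors and for the cost; each of the
    three terms is then replaced by its supremum, one after the other, the
    remaining ones being finite. *)
Lemma plan_of_functional : exists2 gamma : {borel_measure (X1 * X2)%type -> R},
  radon gamma & (ET_functional F1 F2 c mu1 mu2 gamma <= D%:E)%E.
Proof.
have hX := hausdorff_prod h1 h2.
have HL1 : positive_functional L1 := pf_comp fst HL.
have HL2 : positive_functional L2 := pf_comp snd HL.
have [gamma [rgamma gG gT]] := @radon_regularisation R (X1 * X2)%type hX
  (fun A => L \1_A) (pf_indic_ge0 HL) (pf_indicU HL) functional_tight.
exists gamma => //.
have [g1 e1] := marginal1_measure gamma; have [g2 e2] := marginal2_measure gamma.
have rg := radon_inner_regular hX rgamma.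
have rg1 : inner_regular g1.
  by apply: (inner_regular_pushforward hX h1 _ rg e1) => x; exact: cvg_fst.
have rg2 : inner_regular g2.
  by apply: (inner_regular_pushforward hX h2 _ rg e2) => x; exact: cvg_snd.
have gL G : open G -> mass gamma G <= L \1_G.
  by move=> oG; rewrite -lee_fin -massE; [exact: gG|exact: open_borel].
have gL1 G : open G -> mass g1 G <= L1 \1_G.
  move=> oG; rewrite /mass e1.
  apply: gL; rewrite -[X in open X]/(fst @^-1` G).
  by apply: open_comp => // x _; exact: cvg_fst.
have gL2 G : open G -> mass g2 G <= L2 \1_G.
  move=> oG; rewrite /mass e2.
  apply: gL; rewrite -[X in open X]/(snd @^-1` G).
  by apply: open_comp => // x _; exact: cvg_snd.
have gT1 : L1 (fun=> 1) = mass g1 setT.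
  by rewrite /mass e1 /marginal1 /pushforward preimage_setT gT/= pf_indicT.
have gT2 : L2 (fun=> 1) = mass g2 setT.
  by rewrite /mass e2 /marginal2 /pushforward preimage_setT gT/= pf_indicT.
have key n (idx : borelType X1 -> nat) (a : nat -> R)
    n' (idx' : borelType X2 -> nat) (a' : nat -> R) f :
    measurable_fun setT idx -> (forall x, (idx x < n)%N) ->
    (forall j, Fcirc F1 (a j) \is a fin_num) ->
    measurable_fun setT idx' -> (forall x, (idx' x < n')%N) ->
    (forall j, Fcirc F2 (a' j) \is a fin_num) ->
    bounded_fun_set f -> (forall x, (f x)%:E <= c x)%E ->
    partition_value F1 g1 mu1 n idx a + partition_value F2 g2 mu2 n' idx' a' + L f <= D.
  move=> m i af m' i' af' bf fc; apply/ler_addgt0Pr => e e0.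
  have e20 : 0 < e / 2 by rewrite divr_gt0.
  have [phi1 adm1 le1] := lsc_approximation h1 HL1 GF1 rmu1 rg1 gL1 gT1 m i af e20.
  have [phi2 adm2 le2] := lsc_approximation h2 HL2 GF2 rmu2 rg2 gL2 gT2 m' i' af' e20.
  have := L_dual (phi := (phi1, phi2)) (conj adm1 adm2) bf fc.
  by move: le1 le2; rewrite /L1 /L2 /dual_real/= /comp; lra.
pose idx0 (X : ptopologicalType) (x : borelType X) := 0%N.
have m0 (X : ptopologicalType) : measurable_fun setT (@idx0 X) by exact: measurable_cst.
have z1 (j : nat) := (Fcirc0_fin GF1 (lexx 0)).1.
have z2 (j : nat) := (Fcirc0_fin GF2 (lexx 0)).1.
have b0 : @bounded_fun_set R (X1 * X2)%type (fun=> 0) by exact: bounded_cst.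
have c0 x : ((0 : R)%:E <= c x)%E by [].
rewrite /ET_functional -e1 -e2.
have E1 n' idx' a' f : measurable_fun setT idx' -> (forall x, (idx' x < n')%N) ->
    (forall j, Fcirc F2 (a' j) \is a fin_num) ->
    bounded_fun_set f -> (forall x, (f x)%:E <= c x)%E ->
    (relative_entropy F1 g1 mu1 <=
     (D - partition_value F2 g2 mu2 n' idx' a' - L f)%:E)%E.
  move=> m' i' af' bf fc; apply: (relative_entropy_le GF1) => n idx a m i af.
  by rewrite !lerBrDr addrAC; exact: key.
have fin1 : relative_entropy F1 g1 mu1 \is a fin_num.
  rewrite ge0_fin_numE ?relative_entropy_ge0//.
  by apply: le_lt_trans (E1 1%N (@idx0 X2) _ _ (m0 _) _ z2 b0 c0) _ => //; exact: ltry.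
have E2 f : bounded_fun_set f -> (forall x, (f x)%:E <= c x)%E ->
    (relative_entropy F2 g2 mu2 <=
     (D - fine (relative_entropy F1 g1 mu1) - L f)%:E)%E.
  move=> bf fc; apply: (relative_entropy_le GF2) => n idx a m i af.
  have := E1 _ _ _ _ m i af bf fc; rewrite -(fineK fin1) lee_fin !lerBrDr.
  by rewrite [X in _ -> X <= _]addrC addrA addrAC.
have fin2 : relative_entropy F2 g2 mu2 \is a fin_num.
  rewrite ge0_fin_numE ?relative_entropy_ge0//.
  by apply: le_lt_trans (E2 _ b0 c0) _; exact: ltry.
have E3 : (\int[gamma]_x c x <= (D - fine (relative_entropy F1 g1 mu1) -
     fine (relative_entropy F2 g2 mu2))%:E)%E.
  apply: (cost_regularisation hX HL rg c_ge0 c_lsc gL) => f bf fc.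
  have := E2 f bf fc; rewrite -(fineK fin2) lee_fin !lerBrDr.
  by rewrite [fine _ + L f]addrC.
rewrite -(fineK fin1) -(fineK fin2) -EFinD.
apply: le_trans (leeD2l _ E3) _.
by rewrite -EFinD lee_fin -[D - _ - _]addrA -opprD subrKC.
Qed.

End StrongDuality.

Theorem theorem4p11 (R : realType) (X1 X2 : ptopologicalType)
  (F1 F2 : R -> \bar R) (c : (X1 * X2)%type -> \bar R)
  (mu1 : {borel_measure X1 -> R}) (mu2 : {borel_measure X2 -> R}) :
  basic_setting F1 F2 c mu1 mu2 -> coercive F1 F2 c ->
  ET F1 F2 c mu1 mu2 = dual_value F1 F2 c mu1 mu2.
Proof.
move=> st co; have GF1 := Gamma1 st; have GF2 := Gamma2 st.
have c_ge0 := cost_ge0 st.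
apply/eqP; rewrite eq_le; apply/andP; split; last first.
  by apply: dual_value_le_ET => //; exact: (cost_lsc st).
have [Dy|] := ltP (dual_value F1 F2 c mu1 mu2) +oo%E; last first.
  by rewrite leye_eq => /eqP ->; rewrite leey.
have [d1 [d2 [dl [fd1 fd2 dl0 slack]]]] := strict_feasibility GF1 GF2 c_ge0 co.
have P0 : Phi F1 F2 c (fun=> d1, fun=> d2).
  split; [exact: admissible_cst|exact: admissible_cst|move=> x1 x2 /=].
  by apply: le_trans (slack (x1, x2)); rewrite lee_fin; lra.
have Dle phi : Phi F1 F2 c phi ->
    ((dual_real F1 F2 mu1 mu2 phi)%:E <= dual_value F1 F2 c mu1 mu2)%E.
  move=> Pphi; have [adm1 adm2 _] := Pphi.
  rewrite -dual_functionalE; last by split.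
  by apply: ereal_sup_ubound; exists phi.
have Dfin : dual_value F1 F2 c mu1 mu2 \is a fin_num.
  rewrite fin_numElt Dy andbT; exact: lt_le_trans (ltNyr _) (Dle _ P0).
have [|L [HL Lphi]] := @dual_perturbation_functional R X1 X2 F1 F2 c mu1 mu2 GF1 GF2
  d1 d2 dl fd1 fd2 dl0 slack (fine (dual_value F1 F2 c mu1 mu2)).
  by move=> phi Pphi; rewrite -lee_fin fineK//; exact: Dle.
have [gamma rg Eg] := plan_of_functional st co HL Lphi.
rewrite fineK// in Eg.
by apply: le_trans Eg; apply: ereal_inf_lbound; exists gamma.
Qed.
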